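(* (1) $CTDer(Vir)=CInn(Vir)$. (2) Let $\mathcal{G}$ be a finite dimensional simple Lie algebra over $\mathbb{C}$. Then $CTDer(Cur\,\mathcal{G})$ is the set of all $\phi_x\in gc(Cur\,\mathcal{G})$ for which there exist $f(x)\in\mathbb{C}[x]$ and $d_x\in CInn(Cur\,\mathcal{G})$ such that $$\phi_x(a)=f(x)(\partial+x)a+d_x(a)\quad\text{for all } a\in\mathcal{G}.$$
   Context: All vector spaces are over $\mathbb{C}$. A Lie conformal algebra is a $\mathbb{C}[\partial]$-module $\mathcal{R}$ with a $\mathbb{C}$-linear map $\mathcal{R}\otimes\mathcal{R}\to\mathbb{C}[\lambda]\otimes\mathcal{R}$, $a\otimes b\mapsto[a_\lambda b]$, satisfying $[\partial a_\lambda b]=-\lambda[a_\lambda b]$, $[a_\lambda\partial b]=(\partial+\lambda)[a_\lambda b]$, $[a_\lambda b]=-[b_{-\lambda-\partial}a]$, and $[a_\lambda[b_\mu c]]=[[a_\lambda b]_{\lambda+\mu}c]+[b_\mu[a_\lambda c]]$. $Vir=\mathbb{C}[\partial]L$ is the Lie conformal algebra that is free of rank one over $\mathbb{C}[\partial]$ with $[L_\lambda L]=(\partial+2\lambda)L$. For a Lie algebra $\mathcal{G}$, $Cur\,\mathcal{G}=\mathbb{C}[\partial]\otimes\mathcal{G}$ is the Lie conformal algebra with $[a_\lambda b]=[a,b]$ for $a,b\in\mathcal{G}$ (identified with $1\otimes\mathcal{G}$). A conformal linear map on $\mathcal{R}$ is a $\mathbb{C}$-linear map $\phi_x:\mathcal{R}\to\mathbb{C}[x]\otimes\mathcal{R}$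 with $\phi_x(\partial a)=(\partial+x)\phi_x(a)$; the name of the indeterminate is immaterial. The set of these is denoted $gc(\mathcal{R})$. For $a\in\mathcal{R}$, $ad\,a\in gc(\mathcal{R})$ is given by $(ad\,a)_x(b)=[a_xb]$; $CInn(\mathcal{R})=\{ad\,a: a\in\mathcal{R}\}$. $\phi\in gc(\mathcal{R})$ is a conformal triple derivation if for all $a,b,c\in\mathcal{R}$ $$\phi_x([[a_\lambda b]_{\lambda+\mu}c])=[[\phi_x(a)_{\lambda+x}b]_{\lambda+\mu+x}c]+[[a_\lambda\phi_x(b)]_{\lambda+\mu+x}c]+[[a_\lambda b]_{\lambda+\mu}\phi_x(c)];$$ the set of these is $CTDer(\mathcal{R})$. *)

(* Defs.v *)
From HB Require Import structures.
From mathcomp Require Import all_boot all_order all_algebra finmap.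
From mathcomp Require Import boolp classical_sets reals complex.
From mathcomp Require Import -(notations) monalg.
From mathcomp Require Import mpoly.
From mathcomp Require Import ring.

Set Implicit Arguments.
Unset Strict Implicit.
Unset Printing Implicit Defensive.

Import GRing.Theory.

Local Open Scope ring_scope.

Lemma morphD0 (V W : zmodType) (f : V -> W) : {morph f : u v / u + v} -> f 0 = 0.
Proof. by move=> fD; apply: (addrI (f 0)); rewrite -fD !addr0. Qed.

(* The additive map sending a finite sum of v x^i to that of h i v, for h i
   additive. *)
HB.lock Definition mext (I : choiceType) (V W : zmodType) (h : I -> V -> W)
    (u : malg I V) : W :=
  \sum_(i <- monalg.msupp u) h i (monalg.mcoeff i u).

Lemma morphDN (V W : zmodType) (f : V -> W) : {morph f : u v / u + v} ->
  {morph f : u / - u}.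
Proof.
by move=> fD u; apply: (addrI (f u)); rewrite -fD !subrr; apply: morphD0.
Qed.

Section FinExt.

Lemma big_supp (I : eqType) (W : zmodType) (s r : seq I) (F : I -> W) :
  uniq s -> uniq r -> {subset s <= r} -> {in r, forall i, i \notin s -> F i = 0} ->
  \sum_(i <- s) F i = \sum_(i <- r) F i.
Proof.
move=> us ur sr F0.
rewrite [RHS](bigID (mem s)) /= [X in _ + X]big1_seq ?addr0.
  rewrite -[RHS]big_filter; apply: perm_big; apply: uniq_perm => //.
    by rewrite filter_uniq.
  by move=> i; rewrite mem_filter; case: (boolP (i \in s)) => //= /sr ->.
by move=> i /andP [is_ ir]; apply: F0.
Qed.

Variables (I : choiceType) (V W : zmodType) (h : I -> V -> W).
Hypothesis hD : forall i, {morph h i : a b / a + b}.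

Lemma mext_h0 i : h i 0 = 0.
Proof. by apply: (addrI (h i 0)); rewrite -hD !addr0. Qed.

Lemma mextEw (u : malg I V) (r : seq I) : uniq r ->
  {subset monalg.msupp u <= r} -> mext h u = \sum_(i <- r) h i (monalg.mcoeff i u).
Proof.
rewrite mext.unlock => ur sr; apply: big_supp => //.
by move=> i _ /monalg.mcoeff_outdom ->; apply: mext_h0.
Qed.

Lemma mextD : {morph mext h : u v / u + v}.
Proof.
move=> u v; pose r := undup (monalg.msupp u ++ monalg.msupp v).
have ur : uniq r by rewrite undup_uniq.
rewrite !(@mextEw _ r) //.
- by rewrite -big_split; apply: eq_bigr => i _; rewrite monalg.mcoeffD hD.
- by move=> i iv; rewrite mem_undup mem_cat iv orbT.
- by move=> i iv; rewrite mem_undup mem_cat iv.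
move=> i /(fsubsetP (monalg.msuppD_le u v)).
by rewrite in_fsetU mem_undup mem_cat.
Qed.

Lemma mextU i v : mext h (mkmalgU i v) = h i v.
Proof.
rewrite (@mextEw _ [:: i]) // ?big_seq1 ?monalg.mcoeffUU //.
by move=> j /(fsubsetP monalg.msuppU_le); rewrite in_fset1 inE.
Qed.

End FinExt.


Lemma malg_ind (I : choiceType) (V : zmodType) (P : malg I V -> Prop) :
  P 0 -> (forall u v, P u -> P v -> P (u + v)) -> (forall i v, P (mkmalgU i v)) ->
  forall u, P u.
Proof. by move=> P0 PD PU u; rewrite (monalg.monalgE u); elim/big_ind: _. Qed.

(* V[x_1, ..., x_n]: polynomials with coefficients in an S-module V, as a
   module over S[x_1, ..., x_n]. *)
Definition mvpoly (n : nat) (V : zmodType) := malg 'X_{1..n} V.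

Notation "{ 'mvpoly' V [ n ] }" := (mvpoly n V)
  (at level 0, V, n at level 2, format "{ 'mvpoly'  V [ n ] }") : type_scope.

HB.instance Definition _ n V := GRing.Zmodule.on (mvpoly n V).

(* The term v x^m. *)
HB.lock Definition mvpolyU n (V : zmodType) (m : 'X_{1..n}) (v : V) : {mvpoly V[n]} :=
  mkmalgU m v.
Arguments mvpolyU {n V} m v.

Definition mvpolyC n (V : zmodType) (v : V) : {mvpoly V[n]} := mvpolyU 0%MM v.

Lemma mvpolyUD n (V : zmodType) (m : 'X_{1..n}) :
  {morph @mvpolyU n V m : u v / u + v}.
Proof. by move=> u v; rewrite mvpolyU.unlock; apply: monalgUD. Qed.

Lemma mvpoly_ind n (V : zmodType) (P : {mvpoly V[n]} -> Prop) :
  P 0 -> (forall u v, P u -> P v -> P (u + v)) -> (forall m v, P (mvpolyU m v)) ->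
  forall u, P u.
Proof. by rewrite mvpolyU.unlock; apply: malg_ind. Qed.

(* The additive map sending v x^m to h m v, for h m additive. *)
Definition mvext n (V W : zmodType) (h : 'X_{1..n} -> V -> W) : {mvpoly V[n]} -> W :=
  mext h.

Lemma mvextD n (V W : zmodType) (h : 'X_{1..n} -> V -> W) :
  (forall m, {morph h m : a b / a + b}) -> {morph mvext h : u v / u + v}.
Proof. exact: mextD. Qed.

Lemma mvextU n (V W : zmodType) (h : 'X_{1..n} -> V -> W) :
  (forall m, {morph h m : a b / a + b}) -> forall m v, mvext h (mvpolyU m v) = h m v.
Proof. by rewrite mvpolyU.unlock; apply: mextU. Qed.

Notation "v %:V" := (mvpolyC _ v) (at level 2, left associativity, format "v %:V").

HB.lock Definition mvscale (S : comNzRingType) (V : lmodType S) (n : nat)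
    (s : {mpoly S[n]}) (u : {mvpoly V[n]}) : {mvpoly V[n]} :=
  \sum_(m <- msupp s) mvext (fun k v => mvpolyU (m + k)%MM (mcoeff m s *: v)) u.

Section MvpolyModule.
Variables (S : comNzRingType) (V : lmodType S) (n : nat).
Implicit Types (s t : {mpoly S[n]}) (u v : {mvpoly V[n]}).

Local Notation mvscale := (@mvscale S V n).

Let mvscale_at (m : 'X_{1..n}) (c : S) : {mvpoly V[n]} -> {mvpoly V[n]} :=
  mvext (fun k (v : V) => mvpolyU (m + k)%MM (c *: v)).

Lemma mvscale_atD m c : {morph mvscale_at m c : u v / u + v}.
Proof. by apply: mvextD => k a b; rewrite scalerDr mvpolyUD. Qed.

Lemma mvscale_atU m c k (w : V) : mvscale_at m c (mvpolyU k w) = mvpolyU (m + k)%MM (c *: w).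
Proof. by rewrite /mvscale_at mvextU // => i a b; rewrite scalerDr mvpolyUD. Qed.

Lemma mvscale_at0 m c : mvscale_at m c 0 = 0.
Proof. by apply: (addrI (mvscale_at m c 0)); rewrite -mvscale_atD !addr0. Qed.

Lemma mvscale_atDl m c d u : mvscale_at m (c + d) u = mvscale_at m c u + mvscale_at m d u.
Proof.
elim/mvpoly_ind: u => [|u v IHu IHv|k w]; first by rewrite !mvscale_at0 addr0.
  by rewrite !mvscale_atD IHu IHv addrACA.
by rewrite !mvscale_atU scalerDl mvpolyUD.
Qed.

Lemma mvscale_at0l m u : mvscale_at m 0 u = 0.
Proof. by apply: (addrI (mvscale_at m 0 u)); rewrite -mvscale_atDl !addr0. Qed.

Lemma mvscaleEw s u (r : seq 'X_{1..n}) : uniq r -> {subset msupp s <= r} ->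
  mvscale s u = \sum_(m <- r) mvscale_at m (mcoeff m s) u.
Proof.
rewrite mvscale.unlock => ur sr; apply: big_supp => //.
by move=> i _ /memN_msupp_eq0 ->; apply: mvscale_at0l.
Qed.

Lemma mvscaleDr s u v : mvscale s (u + v) = mvscale s u + mvscale s v.
Proof.
by rewrite mvscale.unlock -big_split; apply: eq_bigr => m _; apply: mvscale_atD.
Qed.

Lemma mvscaleDl u s t : mvscale (s + t) u = mvscale s u + mvscale t u.
Proof.
pose r := undup (msupp s ++ msupp t).
have ur : uniq r by rewrite undup_uniq.
rewrite !(@mvscaleEw _ _ r) //.
- by rewrite -big_split; apply: eq_bigr => i _; rewrite mcoeffD mvscale_atDl.
- by move=> i iv; rewrite mem_undup mem_cat iv orbT.
- by move=> i iv; rewrite mem_undup mem_cat iv.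
by move=> i /msuppD_le; rewrite mem_undup.
Qed.

Lemma mvscaleU c m k (w : V) :
  mvscale (c *: 'X_[m]) (mvpolyU k w) = mvpolyU (m + k)%MM (c *: w).
Proof.
rewrite (@mvscaleEw _ _ [:: m]) // ?big_seq1 ?mvscale_atU.
  by rewrite mcoeffZ mcoeffX eqxx mulr1.
by move=> i /msuppZ_le; rewrite msuppX.
Qed.

Lemma mvscale0r s : mvscale s 0 = 0.
Proof. by apply: (addrI (mvscale s 0)); rewrite -mvscaleDr !addr0. Qed.

Lemma mvscale0l u : mvscale 0 u = 0.
Proof. by apply: (addrI (mvscale 0 u)); rewrite -mvscaleDl !addr0. Qed.

Lemma mvscaleA s t u : mvscale s (mvscale t u) = mvscale (s * t) u.
Proof.
elim/mvpoly_ind: u => [|u v IHu IHv|k w]; first by rewrite !mvscale0r.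
  by rewrite !mvscaleDr IHu IHv.
elim/mpolyind: s => [|c m s _ _ IHs]; first by rewrite mul0r !mvscale0l.
rewrite mulrDl !mvscaleDl IHs; congr (_ + _) => {IHs}.
elim/mpolyind: t => [|d q t _ _ IHt]; first by rewrite mulr0 !mvscale0l mvscale0r.
rewrite mulrDr !mvscaleDl mvscaleDr IHt; congr (_ + _) => {IHt}.
by rewrite -scalerAl -scalerAr scalerA -mpolyXD !mvscaleU scalerA addmA.
Qed.

Lemma mvscale1 u : mvscale 1 u = u.
Proof.
elim/mvpoly_ind: u => [|u v IHu IHv|k w]; first by rewrite mvscale0r.
  by rewrite mvscaleDr IHu IHv.
by rewrite -[1]scale1r -mpolyX0 mvscaleU scale1r add0m.
Qed.

HB.instance Definition _ := GRing.Zmodule_isLmodule.Build {mpoly S[n]} (mvpoly n V)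
  mvscaleA mvscale1 mvscaleDr mvscaleDl.

End MvpolyModule.

Section MvpolyModuleTheory.
Variables (S : comNzRingType) (V : lmodType S) (n : nat).

Lemma mvpoly_scaleU (c : S) m k (v : V) :
  (c *: 'X_[m] : {mpoly S[n]}) *: mvpolyU k v = mvpolyU (m + k)%MM (c *: v).
Proof. exact: mvscaleU. Qed.

Lemma mvpoly_scaleX m k (v : V) :
  ('X_[m] : {mpoly S[n]}) *: mvpolyU k v = mvpolyU (m + k)%MM v.
Proof. by rewrite -['X_[m]]scale1r mvpoly_scaleU scale1r. Qed.

Lemma mvpoly_scaleC (c : S) k (v : V) :
  (c%:MP : {mpoly S[n]}) *: mvpolyU k v = mvpolyU k (c *: v).
Proof. by rewrite -[c%:MP]mulr1 mul_mpolyC -mpolyX0 mvpoly_scaleU add0m. Qed.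

Lemma mvpolyUE m (v : V) : mvpolyU m v = ('X_[m] : {mpoly S[n]}) *: v%:V.
Proof. by rewrite mvpoly_scaleX addm0. Qed.

Lemma mvpolyCD : {morph @mvpolyC n V : u v / u + v}.
Proof. exact: mvpolyUD. Qed.

Lemma mvpolyCZ (c : S) (v : V) :
  (c *: v)%:V = (c%:MP : {mpoly S[n]}) *: v%:V :> {mvpoly V[n]}.
Proof. by rewrite mvpoly_scaleC. Qed.

End MvpolyModuleTheory.

(* Throughout, R is a C[d]-module ('X : {poly K} acts as d), C[x_1, ..., x_n] (x) R
   is {mvpoly R[n]}, and C[d][x_1, ..., x_n] acts on it. *)
HB.lock Definition del (K : fieldType) n : {mpoly {poly K}[n]} := 'X%:MP.
Arguments del {K n}.

(* p(s): the indeterminate of p replaced by s, which acts on the left of the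
   coefficients of p. *)
HB.lock Definition msubst (K : fieldType) (R : lmodType {poly K}) n
    (s : {mpoly {poly K}[n]}) (p : {mvpoly R[1]}) : {mvpoly R[n]} :=
  mvext (fun m v => s ^+ m ord0 *: (v%:V : {mvpoly R[n]})) p.

(* phi_s(u): phi extended C[x_1, ..., x_n]-linearly. *)
HB.lock Definition cext (K : fieldType) (R : lmodType {poly K})
    (phi : R -> {mvpoly R[1]}) n (s : {mpoly {poly K}[n]}) (u : {mvpoly R[n]}) :
    {mvpoly R[n]} :=
  mvext (fun m a => 'X_[m] *: msubst s (phi a)) u.

(* [u_s v]: the bracket extended C[x_1, ..., x_n]-bilinearly. *)
HB.lock Definition lext (K : fieldType) (R : lmodType {poly K})
    (br : R -> R -> {mvpoly R[1]}) n (s : {mpoly {poly K}[n]}) (u v : {mvpoly R[n]}) :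
    {mvpoly R[n]} :=
  mvext (fun m a => 'X_[m] *: cext (br a) s v) u.

Section CextTheory.
Variables (K : fieldType) (R : lmodType {poly K}) (n : nat).
Implicit Types (s t : {mpoly {poly K}[n]}) (p : {mvpoly R[1]}) (u v : {mvpoly R[n]}).

Lemma msubstD s : {morph @msubst K R n s : p q / p + q}.
Proof.
rewrite msubst.unlock; apply: mvextD => m a b.
by rewrite -scalerDr -mvpolyCD.
Qed.

Lemma msubstU s m (v : R) : msubst s (mvpolyU m v) = s ^+ m ord0 *: (v%:V : {mvpoly R[n]}).
Proof.
by rewrite msubst.unlock mvextU // => k a b; rewrite -scalerDr -mvpolyCD.
Qed.

Lemma msubstC s (v : R) : msubst s (v%:V) = (v%:V : {mvpoly R[n]}).
Proof. by rewrite msubstU mnm0E expr0 scale1r. Qed.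

Lemma msubst0 s : msubst s 0 = 0 :> {mvpoly R[n]}.
Proof. exact: morphD0 (msubstD s). Qed.

Lemma msubstN s p : msubst s (- p) = - msubst s p :> {mvpoly R[n]}.
Proof. by apply: (addrI (msubst s p)); rewrite -msubstD !subrr msubst0. Qed.

Lemma msubst_scaleC s (c : {poly K}) p : msubst s (c%:MP *: p) = c%:MP *: msubst s p.
Proof.
elim/mvpoly_ind: p => [|p q IHp IHq|m v]; first by rewrite !(scaler0, msubst0).
  by rewrite scalerDr !msubstD IHp IHq scalerDr.
by rewrite mvpoly_scaleC !msubstU mvpolyCZ !scalerA mulrC.
Qed.

Lemma mvpolyCX (a : R) : ('X *: a)%:V = del *: a%:V :> {mvpoly R[n]}.
Proof. by rewrite del.unlock mvpolyCZ. Qed.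

Lemma msubst_del s p : msubst s (del *: p) = del *: msubst s p.
Proof. by rewrite del.unlock msubst_scaleC. Qed.

Lemma msubst_scaleX s p : msubst s ('X_ord0 *: p) = s *: msubst s p.
Proof.
elim/mvpoly_ind: p => [|p q IHp IHq|m v]; first by rewrite !(scaler0, msubst0).
  by rewrite scalerDr !msubstD IHp IHq scalerDr.
by rewrite mvpoly_scaleX !msubstU mnmDE mnm1E eqxx exprD expr1 scalerA.
Qed.

Section Cext.
Variable phi : R -> {mvpoly R[1]}.
Hypothesis phiD : {morph phi : a b / a + b}.

Let cextD_h s m : {morph (fun a => 'X_[m] *: msubst s (phi a) : {mvpoly R[n]}) : a b / a + b}.
Proof. by move=> a b; rewrite phiD msubstD scalerDr. Qed.

Lemma cextD s : {morph cext phi s : u v / u + v : {mvpoly R[n]}}.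
Proof. by rewrite cext.unlock; apply: mvextD => m; apply: cextD_h. Qed.

Lemma cextU s m a : cext phi s (mvpolyU m a) = 'X_[m] *: msubst s (phi a) :> {mvpoly R[n]}.
Proof. by rewrite cext.unlock mvextU // => k; apply: cextD_h. Qed.

Lemma cextC s a : cext phi s a%:V = msubst s (phi a) :> {mvpoly R[n]}.
Proof. by rewrite cextU mpolyX0 scale1r. Qed.

Lemma cext0 s : cext phi s 0 = 0 :> {mvpoly R[n]}.
Proof. exact: morphD0 (cextD s). Qed.

Lemma cext_scaleX s m u : cext phi s ('X_[m] *: u) = 'X_[m] *: cext phi s u.
Proof.
elim/mvpoly_ind: u => [|u v IHu IHv|k v]; first by rewrite !(scaler0, cext0).
  by rewrite scalerDr !cextD IHu IHv scalerDr.
by rewrite mvpoly_scaleX !cextU scalerA mpolyXD.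
Qed.

Lemma cext_scale s c (d : {mpoly {poly K}[1]}) t u :
  (forall a, phi (c *: a) = d *: phi a) ->
  (forall p, msubst s (d *: p) = t *: msubst s p :> {mvpoly R[n]}) ->
  cext phi s (c%:MP *: u) = t *: cext phi s u.
Proof.
move=> phic std; elim/mvpoly_ind: u => [|u v IHu IHv|k v].
- by rewrite !(scaler0, cext0).
- by rewrite scalerDr !cextD IHu IHv scalerDr.
by rewrite mvpoly_scaleC !cextU phic std !scalerA mulrC.
Qed.

End Cext.

Section Lext.
Variable br : R -> R -> {mvpoly R[1]}.
Hypothesis brDl : forall b, {morph br^~ b : a a' / a + a'}.
Hypothesis brDr : forall a, {morph br a : b b' / b + b'}.
Hypothesis brZl : forall c a b, br (c%:P *: a) b = c%:P%:MP *: br a b.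
Hypothesis brZr : forall c a b, br a (c%:P *: b) = c%:P%:MP *: br a b.
Hypothesis brXl : forall a b, br ('X *: a) b = - 'X_ord0 *: br a b.
Hypothesis brXr : forall a b, br a ('X *: b) = (del + 'X_ord0) *: br a b.

Let brDl' a a' b : br (a + a') b = br a b + br a' b. Proof. exact: brDl. Qed.

Lemma lext_cextDl s v a a' :
  cext (br (a + a')) s v = cext (br a) s v + cext (br a') s v :> {mvpoly R[n]}.
Proof.
elim/mvpoly_ind: v => [|u v IHu IHv|k v]; first by rewrite !cext0 ?addr0 //; apply: brDr.
  by rewrite !cextD ?IHu ?IHv 1?addrACA //; apply: brDr.
by rewrite !cextU ?brDl' ?msubstD ?scalerDr //; apply: brDr.
Qed.

Let lextD_h s v m : {morph (fun a => 'X_[m] *: cext (br a) s v : {mvpoly R[n]}) : a b / a + b}.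
Proof. by move=> a b; rewrite lext_cextDl scalerDr. Qed.

Lemma lextDl s u u' v :
  lext br s (u + u') v = lext br s u v + lext br s u' v :> {mvpoly R[n]}.
Proof. by rewrite lext.unlock; apply: mvextD => m; apply: lextD_h. Qed.

Lemma lextU s m a v : lext br s (mvpolyU m a) v = 'X_[m] *: cext (br a) s v :> {mvpoly R[n]}.
Proof. by rewrite lext.unlock mvextU // => k; apply: lextD_h. Qed.

Lemma lext0l s v : lext br s 0 v = 0 :> {mvpoly R[n]}.
Proof. exact: morphD0 (fun u u' => lextDl s u u' v). Qed.

Lemma lextDr s u v v' :
  lext br s u (v + v') = lext br s u v + lext br s u v' :> {mvpoly R[n]}.
Proof.
elim/mvpoly_ind: u => [|u w IHu IHw|k w]; first by rewrite !lext0l addr0.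
  by rewrite !lextDl IHu IHw addrACA.
by rewrite !lextU cextD ?scalerDr //; apply: brDr.
Qed.

Lemma lext0r s u : lext br s u 0 = 0 :> {mvpoly R[n]}.
Proof. exact: morphD0 (lextDr s u). Qed.

Lemma lextCC s a b : lext br s a%:V b%:V = msubst s (br a b) :> {mvpoly R[n]}.
Proof. by rewrite lextU mpolyX0 scale1r cextC //; apply: brDr. Qed.

Lemma lextXl s m u v : lext br s ('X_[m] *: u) v = 'X_[m] *: lext br s u v.
Proof.
elim/mvpoly_ind: u => [|u w IHu IHw|k w]; first by rewrite !(scaler0, lext0l).
  by rewrite scalerDr !lextDl IHu IHw scalerDr.
by rewrite mvpoly_scaleX !lextU mpolyXD scalerA.
Qed.

Lemma lextXr s m u v : lext br s u ('X_[m] *: v) = 'X_[m] *: lext br s u v.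
Proof.
elim/mvpoly_ind: u => [|u w IHu IHw|k w]; first by rewrite !(scaler0, lext0l).
  by rewrite !lextDl IHu IHw scalerDr.
by rewrite !lextU cext_scaleX ?scalerA 1?mulrC //; apply: brDr.
Qed.

Lemma lextUU s m k a b : lext br s (mvpolyU m a) (mvpolyU k b) =
  'X_[m + k] *: msubst s (br a b) :> {mvpoly R[n]}.
Proof. by rewrite lextU cextU ?scalerA -?mpolyXD //; apply: brDr. Qed.

Lemma lext_scalel s c (d : {mpoly {poly K}[1]}) t u v :
  (forall a b, br (c *: a) b = d *: br a b) ->
  (forall p, msubst s (d *: p) = t *: msubst s p :> {mvpoly R[n]}) ->
  lext br s (c%:MP *: u) v = t *: lext br s u v.
Proof.
move=> brc std; elim/mvpoly_ind: u => [|u w IHu IHw|k w].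
- by rewrite !(scaler0, lext0l).
- by rewrite scalerDr !lextDl IHu IHw scalerDr.
elim/mvpoly_ind: v => [|u v IHu IHv|m v].
- by rewrite !(scaler0, lext0r).
- by rewrite !lextDr IHu IHv scalerDr.
by rewrite mvpoly_scaleC !lextUU brc std !scalerA mulrC.
Qed.

Lemma lext_scaler s c (d : {mpoly {poly K}[1]}) t u v :
  (forall a b, br a (c *: b) = d *: br a b) ->
  (forall p, msubst s (d *: p) = t *: msubst s p :> {mvpoly R[n]}) ->
  lext br s u (c%:MP *: v) = t *: lext br s u v.
Proof.
move=> brc std; elim/mvpoly_ind: u => [|u w IHu IHw|k w].
- by rewrite !(scaler0, lext0l).
- by rewrite !lextDl IHu IHw scalerDr.
rewrite !lextU (cext_scale (brDr w) (d := d) (t := t)) ?scalerA 1?mulrC //.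
Qed.

Lemma lextdl s u v : lext br s (del *: u) v = - s *: lext br s u v.
Proof.
rewrite del.unlock; apply: lext_scalel brXl _ => p.
by rewrite !scaleNr -scalerN msubst_scaleX msubstN scalerN.
Qed.

Lemma lextdr s u v : lext br s u (del *: v) = (del + s) *: lext br s u v.
Proof.
rewrite [in LHS]del.unlock; apply: lext_scaler brXr _ => p.
by rewrite !scalerDl msubstD msubst_del msubst_scaleX.
Qed.

Lemma lextZl s c u v : lext br s (c%:P%:MP *: u) v = c%:P%:MP *: lext br s u v.
Proof. by apply: lext_scalel (brZl c) _ => p; rewrite msubst_scaleC. Qed.

Lemma lextZr s c u v : lext br s u (c%:P%:MP *: v) = c%:P%:MP *: lext br s u v.
Proof. by apply: lext_scaler (brZr c) _ => p; rewrite msubst_scaleC. Qed.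

Definition lbr_skew_at (a b : R) := br a b = - msubst (- 'X_0 - del) (br b a).

Definition lbr_jacobi_at (a b c : R) :=
  let la : {mpoly {poly K}[2]} := 'X_0 in
  let mu : {mpoly {poly K}[2]} := 'X_1 in
  lext br la a%:V (lext br mu b%:V c%:V) =
  lext br (la + mu) (lext br la a%:V b%:V) c%:V +
  lext br mu b%:V (lext br la a%:V c%:V).

End Lext.
End CextTheory.

Section Generation.
Variables (K : fieldType) (R : lmodType {poly K}).
Variable br : R -> R -> {mvpoly R[1]}.
Hypothesis brDl : forall b, {morph br^~ b : a a' / a + a'}.
Hypothesis brDr : forall a, {morph br a : b b' / b + b'}.
Hypothesis brZl : forall c a b, br (c%:P *: a) b = c%:P%:MP *: br a b.
Hypothesis brZr : forall c a b, br a (c%:P *: b) = c%:P%:MP *: br a b.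
Hypothesis brXl : forall a b, br ('X *: a) b = - 'X_0 *: br a b.
Hypothesis brXr : forall a b, br a ('X *: b) = (del + 'X_0) *: br a b.
Variable P : R -> Prop.
Hypothesis Pgen : forall Q : R -> Prop, (forall a b, Q a -> Q b -> Q (a + b)) ->
  (forall c a, Q a -> Q (c%:P *: a)) -> (forall a, Q a -> Q ('X *: a)) ->
  (forall a, P a -> Q a) -> forall a, Q a.

Lemma lbr_skew_gen : (forall a b, P a -> P b -> lbr_skew_at br a b) ->
  forall a b, lbr_skew_at br a b.
Proof.
move=> skP; apply: Pgen => [a a' IH IH' b|c a IH b|a IH b|a Pa].
- by rewrite /lbr_skew_at brDr (brDl b) IH IH' msubstD opprD.
- by rewrite /lbr_skew_at brZr brZl IH msubst_scaleC scalerN.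
- rewrite /lbr_skew_at brXr brXl IH scalerDl msubstD msubst_del msubst_scaleX.
  by rewrite -scalerDl addrCA subrr addr0 scalerN.
apply: Pgen => [b b' IH IH'|c b IH|b IH|b Pb]; last exact: skP.
- by rewrite /lbr_skew_at brDr (brDl a) IH IH' msubstD opprD.
- by rewrite /lbr_skew_at brZr brZl IH msubst_scaleC scalerN.
rewrite /lbr_skew_at brXr brXl IH scaleNr msubstN msubst_scaleX opprK.
by rewrite scalerN -scaleNr opprD addrC.
Qed.

Let Cd (a b : R) : (a + b)%:V = a%:V + b%:V :> {mvpoly R[2]}. Proof. exact: mvpolyCD. Qed.
Let Dl := lextDl (n := 2) brDl brDr.
Let Dr := lextDr (n := 2) brDl brDr.
Let Nl s u v : lext br s (- u) v = - lext br s u v :> {mvpoly R[2]}.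
Proof. exact: morphDN (fun u u' => Dl s u u' v) u. Qed.
Let Nr s u v : lext br s u (- v) = - lext br s u v :> {mvpoly R[2]}.
Proof. exact: morphDN (Dr s u) v. Qed.
Let ext := (Cd, Dl, Dr).
Let lextXl0 (i : 'I_2) s u v : lext br s ('X_i *: u) v = 'X_i *: lext br s u v.
Proof. exact: lextXl brDl brDr _ _ _ _. Qed.
Let lextXr0 (i : 'I_2) s u v : lext br s u ('X_i *: v) = 'X_i *: lext br s u v.
Proof. exact: lextXr brDl brDr _ _ _ _. Qed.
Let zl := lextZl (n := 2) brDl brDr brZl.
Let zr := lextZr (n := 2) brDl brDr brZr.
Let xl := lextdl (n := 2) brDl brDr brXl.
Let xr := lextdr (n := 2) brDl brDr brXr.

Let xr' s u v :
  lext br s u (del *: v) = del *: lext br s u v + s *: lext br s u v :> {mvpoly R[2]}.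
Proof. by rewrite xr scalerDl. Qed.

Lemma lbr_jacobi_gen : (forall a b c, P a -> P b -> P c -> lbr_jacobi_at br a b c) ->
  forall a b c, lbr_jacobi_at br a b c.
Proof.
move=> jP; apply: Pgen => [a a' IH IH' b c|k a IH b c|a IH b c|a Pa].
- by move: (IH b c) (IH' b c); rewrite /lbr_jacobi_at /= !ext => -> ->; rewrite addrACA.
- by move: (IH b c); rewrite /lbr_jacobi_at /= mvpolyCZ !zl zr => ->; rewrite scalerDr.
- move: (IH b c); rewrite /lbr_jacobi_at /= mvpolyCX !xl !scaleNr Nl Nr.
  by rewrite lextXl0 lextXr0 => ->; rewrite -opprD -scalerDr.
apply: Pgen => [b b' IH IH' c|k b IH c|b IH c|b Pb].
- by move: (IH c) (IH' c); rewrite /lbr_jacobi_at /= !ext => -> ->; rewrite addrACA.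
- by move: (IH c); rewrite /lbr_jacobi_at /= mvpolyCZ !(zl, zr) => ->; rewrite scalerDr.
- move: (IH c); rewrite /lbr_jacobi_at /= mvpolyCX !xl xr.
  rewrite !scaleNr Nr lextXr0 !scalerDl Dl xl lextXl0 => ->.
  rewrite scalerDr opprD scaleNr scalerDl opprD; congr (_ + _).
  by rewrite addrAC addNr add0r.
apply: Pgen => [c c' IH IH'|k c IH|c IH|c Pc]; last exact: jP.
- by move: IH IH'; rewrite /lbr_jacobi_at /= !ext => -> ->; rewrite addrACA.
- by move: IH; rewrite /lbr_jacobi_at /= mvpolyCZ !zr => ->; rewrite scalerDr.
move: IH; rewrite /lbr_jacobi_at /= mvpolyCX !xr' !Dr !xr' !lextXr0 => ->.
rewrite -!scalerDl scalerDr addrA; congr (_ + _ *: _).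
by rewrite addrAC.
Qed.

(* The relation [L_s L] = (d + 2s) L. *)
Section Virasoro.
Variable L : R.
Hypothesis brLL : br L L = (del + 'X_0 *+ 2) *: L%:V.

Lemma vir_skew : lbr_skew_at br L L.
Proof.
rewrite /lbr_skew_at brLL mulr2n !scalerDl !msubstD msubst_del !msubst_scaleX.
by rewrite msubstC -!scalerDl -scaleNr; congr (_ *: _); ring.
Qed.

Let LL s : lext br s L%:V L%:V =
  del *: L%:V + (s *: L%:V + s *: L%:V) :> {mvpoly R[2]}.
Proof.
rewrite (lextCC brDl brDr) brLL mulr2n !scalerDl !msubstD msubst_del.
by rewrite !msubst_scaleX !msubstC.
Qed.

Lemma vir_jacobi : lbr_jacobi_at br L L L.
Proof.
rewrite /lbr_jacobi_at /= !LL !Dl !Dr !xl !xr' !lextXl0 !lextXr0 !LL.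
rewrite -!scalerDl !scalerA -!scalerDl.
by congr (_ *: _); ring.
Qed.

End Virasoro.

End Generation.

HB.mixin Record isLieConformal (K : fieldType) R of GRing.Lmodule {poly K} R := {
  lbr : R -> R -> {mvpoly R[1]};
  lbrDl : forall b, {morph lbr^~ b : a a' / a + a'};
  lbrDr : forall a, {morph lbr a : b b' / b + b'};
  lbrZl : forall (c : K) a b, lbr (c%:P *: a) b = c%:P%:MP *: lbr a b;
  lbrZr : forall (c : K) a b, lbr a (c%:P *: b) = c%:P%:MP *: lbr a b;
  lbrXl : forall a b, lbr ('X *: a) b = - 'X_0 *: lbr a b;
  lbrXr : forall a b, lbr a ('X *: b) = (del + 'X_0) *: lbr a b;
  lbr_skew : forall a b, lbr_skew_at lbr a b;
  lbr_jacobi : forall a b c, lbr_jacobi_at lbr a b c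
}.

#[short(type="lieConformalType")]
HB.structure Definition LieConformal (K : fieldType) :=
  {R of isLieConformal K R & GRing.Lmodule {poly K} R}.

HB.mixin Record isLieAlgebra (K : fieldType) G of GRing.Lmodule K G := {
  lie : G -> G -> G;
  lie_linearl : forall y, linear (lie^~ y);
  lie_linearr : forall x, linear (lie x);
  lie_alt : forall x, lie x x = 0;
  lie_jacobi : forall x y z,
    lie x (lie y z) + lie y (lie z x) + lie z (lie x y) = 0
}.

#[short(type="lieAlgType")]
HB.structure Definition LieAlgebra (K : fieldType) :=
  {G of isLieAlgebra K G & GRing.Lmodule K G}.

#[short(type="vectLieAlgType")]
HB.structure Definition VectLieAlgebra (K : fieldType) :=
  {G of isLieAlgebra K G & Vector K G}.

Definition lie_simple (K : fieldType) (G : vectLieAlgType K) : Prop :=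
  (exists x y : G, lie x y != 0) /\
  forall I : {vspace G}, (forall x y, y \in I -> lie x y \in I) ->
    I = 0%VS \/ I = fullv.


(* f(s), for f in C[x]. *)
Definition psubst (K : fieldType) n (s : {mpoly {poly K}[n]}) (f : {poly K}) :
    {mpoly {poly K}[n]} :=
  (map_poly (@mpolyC n {poly K} \o polyC) f).[s].

Section PsubstTheory.
Variables (K : fieldType) (n : nat) (s : {mpoly {poly K}[n]}).

Lemma psubstD : {morph psubst s : f g / f + g}.
Proof. by move=> f g; rewrite /psubst rmorphD hornerD. Qed.

Lemma psubstM : {morph psubst s : f g / f * g}.
Proof. by move=> f g; rewrite /psubst rmorphM hornerM. Qed.

Lemma psubstC c : psubst s c%:P = c%:P%:MP.
Proof. by rewrite /psubst map_polyC hornerC. Qed.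

Lemma psubstX : psubst s 'X = s.
Proof. by rewrite /psubst map_polyX hornerX. Qed.

End PsubstTheory.

Section Vir.
Variable K : fieldType.

Definition Vir := {poly K}.
HB.instance Definition _ := GRing.Lmodule.copy Vir ({poly K}^o).

Definition vir_L : Vir := 1%R.

Definition vir_br (a b : Vir) : {mvpoly Vir[1]} :=
  (psubst (- 'X_0) a * psubst (del + 'X_0) b * (del + 'X_0 *+ 2)) *: vir_L%:V.

Let brDl b : {morph vir_br^~ b : a a' / a + a'}.
Proof. by move=> a a'; rewrite /vir_br -scalerDl -!mulrDl -psubstD. Qed.

Let brDr a : {morph vir_br a : b b' / b + b'}.
Proof. by move=> b b'; rewrite /vir_br -scalerDl -mulrDl -mulrDr -psubstD. Qed.

Let brZl (c : K) a b : vir_br (c%:P *: a) b = c%:P%:MP *: vir_br a b.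
Proof. by rewrite /vir_br psubstM psubstC scalerA !mulrA. Qed.

Let brZr (c : K) a b : vir_br a (c%:P *: b) = c%:P%:MP *: vir_br a b.
Proof. by rewrite /vir_br psubstM psubstC scalerA mulrCA !mulrA. Qed.

Let brXl a b : vir_br ('X *: a) b = - 'X_0 *: vir_br a b.
Proof. by rewrite /vir_br psubstM psubstX scalerA !mulrA. Qed.

Let brXr a b : vir_br a ('X *: b) = (del + 'X_0) *: vir_br a b.
Proof. by rewrite /vir_br psubstM psubstX scalerA mulrCA !mulrA. Qed.

Lemma vir_brLL : vir_br vir_L vir_L = (del + 'X_0 *+ 2) *: vir_L%:V.
Proof. by rewrite /vir_br /vir_L -polyC1 !psubstC !mul1r. Qed.

Lemma vir_gen (Q : Vir -> Prop) : (forall a b, Q a -> Q b -> Q (a + b)) ->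
  (forall c a, Q a -> Q (c%:P *: a)) -> (forall a, Q a -> Q ('X *: a)) ->
  (forall a, a = vir_L -> Q a) -> forall a, Q a.
Proof.
move=> QD QZ QX QL a; have Q1 : Q vir_L by apply: QL.
elim/poly_ind: a => [|p c IHp].
  by rewrite -[0](scale0r vir_L) -[0 in X in Q X]polyC0; apply: QZ.
apply: QD; first by rewrite mulrC; apply: QX.
by rewrite -[c%:P]mulr1; apply: QZ.
Qed.

Let brS a b : lbr_skew_at vir_br a b.
Proof.
apply: (lbr_skew_gen brDl brDr brZl brZr brXl brXr vir_gen) => {}a {}b -> ->.
apply: vir_skew; apply: vir_brLL.
Qed.

Let brJ a b c : lbr_jacobi_at vir_br a b c.
Proof.
apply: (lbr_jacobi_gen brDl brDr brZl brZr brXl brXr vir_gen) => {}a {}b {}c -> -> ->.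
by apply: (vir_jacobi brDl brDr brXl brXr); apply: vir_brLL.
Qed.

HB.instance Definition _ := isLieConformal.Build K Vir
  brDl brDr brZl brZr brXl brXr brS brJ.

End Vir.

(* V[X], that is S[X] (x) V, as a module over S[X]. *)
Definition upoly (V : zmodType) := malg nat V.

HB.instance Definition _ V := GRing.Zmodule.on (upoly V).

(* X^i (x) v *)
HB.lock Definition upolyU (V : zmodType) (i : nat) (v : V) : upoly V := mkmalgU i v.
Arguments upolyU {V} i v.

Lemma upolyUD (V : zmodType) i : {morph @upolyU V i : u v / u + v}.
Proof. by move=> u v; rewrite upolyU.unlock; apply: monalgUD. Qed.

Lemma upoly_ind (V : zmodType) (P : upoly V -> Prop) :
  P 0 -> (forall u v, P u -> P v -> P (u + v)) -> (forall i v, P (upolyU i v)) ->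
  forall u, P u.
Proof. by rewrite upolyU.unlock; apply: malg_ind. Qed.

(* The additive map sending X^i (x) v to h i v, for h i additive. *)
Definition uext (V W : zmodType) (h : nat -> V -> W) : upoly V -> W := mext h.

Lemma uextD (V W : zmodType) (h : nat -> V -> W) :
  (forall m, {morph h m : a b / a + b}) -> {morph uext h : u v / u + v}.
Proof. exact: mextD. Qed.

Lemma uextU (V W : zmodType) (h : nat -> V -> W) :
  (forall m, {morph h m : a b / a + b}) -> forall m v, uext h (upolyU m v) = h m v.
Proof. by rewrite upolyU.unlock; apply: mextU. Qed.

HB.lock Definition uscale (S : comNzRingType) (V : lmodType S) (p : {poly S})
    (u : upoly V) : upoly V :=
  \sum_(i < size p) uext (fun k (v : V) => upolyU (i + k)%N (p`_i *: v)) u.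

Section UpolyModule.
Variables (S : comNzRingType) (V : lmodType S).
Implicit Types (p q : {poly S}) (u v : upoly V).

Local Notation uscale := (@uscale S V).

Let uscale_at (i : nat) (c : S) : upoly V -> upoly V :=
  uext (fun k (v : V) => upolyU (i + k)%N (c *: v)).

Let uscale_atD i c : {morph uscale_at i c : u v / u + v}.
Proof. by apply: uextD => k a b; rewrite scalerDr upolyUD. Qed.

Let uscale_atU i c k (w : V) : uscale_at i c (upolyU k w) = upolyU (i + k)%N (c *: w).
Proof. by rewrite /uscale_at uextU // => j a b; rewrite scalerDr upolyUD. Qed.

Let uscale_at0 i c : uscale_at i c 0 = 0.
Proof. exact: morphD0 (uscale_atD i c). Qed.

Let uscale_atDl i c d u : uscale_at i (c + d) u = uscale_at i c u + uscale_at i d u.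
Proof.
elim/upoly_ind: u => [|u v IHu IHv|k w]; first by rewrite !uscale_at0 addr0.
  by rewrite !uscale_atD IHu IHv addrACA.
by rewrite !uscale_atU scalerDl upolyUD.
Qed.

Let uscale_at0l i u : uscale_at i 0 u = 0.
Proof. exact: morphD0 (fun c d => uscale_atDl i c d u). Qed.

Let uscaleEw p u n : (size p <= n)%N -> uscale p u = \sum_(0 <= i < n) uscale_at i p`_i u.
Proof.
move=> le_pn; rewrite uscale.unlock (big_cat_nat (n := size p)) //= big_mkord.
rewrite [X in _ = _ + X]big_nat_cond [X in _ = _ + X]big1 ?addr0 // => i.
by case/andP => /andP [le_pi _] _; rewrite nth_default ?uscale_at0l.
Qed.

Lemma uscaleDr p : {morph uscale p : u v / u + v}.
Proof.
by move=> u v; rewrite uscale.unlock -big_split; apply: eq_bigr => m _; apply: uscale_atD.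
Qed.

Lemma uscaleDl u : {morph uscale^~ u : p q / p + q}.
Proof.
move=> p q /=; pose n := maxn (size p) (size q).
rewrite !(@uscaleEw _ _ n) ?leq_maxl ?leq_maxr ?(leq_trans (size_polyD _ _)) //.
by rewrite -big_split; apply: eq_bigr => i _; rewrite coefD uscale_atDl.
Qed.

Lemma uscaleU c i k (w : V) :
  uscale (c *: 'X^i) (upolyU k w) = upolyU (i + k)%N (c *: w).
Proof.
rewrite (@uscaleEw _ _ i.+1); last by rewrite (leq_trans (size_scale_leq _ _)) ?size_polyXn.
rewrite big_nat_recr //= big_nat_cond big1 => [|j /andP [/andP [_ ji] _]].
  by rewrite add0r coefZ coefXn eqxx mulr1 uscale_atU.
by rewrite coefZ coefXn (ltn_eqF ji) mulr0 uscale_at0l.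
Qed.

Lemma uscaleA p q u : uscale p (uscale q u) = uscale (p * q) u.
Proof.
elim/upoly_ind: u => [|u v IHu IHv|k w].
- by rewrite !(morphD0 (uscaleDr _)).
- by rewrite !uscaleDr IHu IHv.
rewrite -[p]coefK -[q]coefK !poly_def.
elim/big_ind: _ => [|p1 p2 IH1 IH2|i _].
- by rewrite mul0r !(morphD0 (uscaleDl _)).
- by rewrite mulrDl !(uscaleDl _ p1 p2) (uscaleDl _ (p1 * _) (p2 * _)) IH1 IH2.
elim/big_ind: _ => [|p1 p2 IH1 IH2|j _].
- by rewrite mulr0 !(morphD0 (uscaleDl _)) (morphD0 (uscaleDr _)).
- by rewrite mulrDr (uscaleDl _ p1 p2) uscaleDr (uscaleDl _ (_ * p1) (_ * p2)) IH1 IH2.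
by rewrite -scalerAl -scalerAr scalerA -exprD !uscaleU scalerA addnA.
Qed.

Lemma uscale1 u : uscale 1 u = u.
Proof.
elim/upoly_ind: u => [|u v IHu IHv|k w].
- exact: morphD0 (uscaleDr _).
- by rewrite uscaleDr IHu IHv.
by rewrite -[1]scale1r -(expr0 'X) uscaleU scale1r.
Qed.

HB.instance Definition _ := GRing.Zmodule_isLmodule.Build {poly S} (upoly V)
  uscaleA uscale1 uscaleDr uscaleDl.

Lemma upoly_scaleX k (v : V) : ('X : {poly S}) *: upolyU k v = upolyU k.+1 v.
Proof. by have := uscaleU 1 1 k v; rewrite expr1 !scale1r. Qed.

Lemma upoly_scaleC c k (v : V) : (c%:P : {poly S}) *: upolyU k v = upolyU k (c *: v).
Proof. by have := uscaleU c 0 k v; rewrite expr0 alg_polyC. Qed.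

End UpolyModule.

Section Cur.
Variables (K : fieldType) (G : lieAlgType K).

Definition Cur := upoly G.
HB.instance Definition _ := GRing.Lmodule.on Cur.

(* The element a of G, that is 1 (x) a. *)
Definition cur_in (a : G) : Cur := upolyU 0 a.

(* [d^i a_x d^j b] = (- x)^i (d + x)^j [a, b] *)
Definition cur_br (u v : Cur) : {mvpoly Cur[1]} :=
  uext (fun i a => uext (fun j b =>
    ((- 'X_0) ^+ i * (del + 'X_0) ^+ j) *: (cur_in (lie a b))%:V) v) u.

Lemma lieDl (a a' b : G) : lie (a + a') b = lie a b + lie a' b.
Proof. by have := lie_linearl b 1 a a'; rewrite /= !scale1r. Qed.

Lemma lieDr (a b b' : G) : lie a (b + b') = lie a b + lie a b'.
Proof. by have := lie_linearr a 1 b b'; rewrite /= !scale1r. Qed.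

Lemma lie0l (b : G) : lie 0 b = 0.
Proof. exact: morphD0 (fun a a' => lieDl a a' b). Qed.

Lemma lie0r (a : G) : lie a 0 = 0.
Proof. exact: morphD0 (lieDr a). Qed.

Lemma lieZl c (a b : G) : lie (c *: a) b = c *: lie a b.
Proof. by have := lie_linearl b c a 0; rewrite /= !addr0 lie0l addr0. Qed.

Lemma lieZr c (a b : G) : lie a (c *: b) = c *: lie a b.
Proof. by have := lie_linearr a c b 0; rewrite /= !addr0 lie0r addr0. Qed.

Lemma lieC (a b : G) : lie a b = - lie b a.
Proof.
have := lie_alt (a + b); rewrite lieDl !lieDr !lie_alt add0r addr0.
by move/eqP; rewrite addr_eq0 => /eqP.
Qed.

Lemma lie_leibniz (a b c : G) : lie a (lie b c) = lie (lie a b) c + lie b (lie a c).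
Proof.
have /eqP := lie_jacobi a b c; rewrite -addrA addr_eq0 => /eqP ->.
rewrite (lieC (lie a b)) (lieC a c) -[- lie c a]scaleN1r lieZr scaleN1r.
by rewrite opprD addrC.
Qed.

Lemma cur_inD : {morph cur_in : a b / a + b}.
Proof. exact: upolyUD. Qed.

Let term (i j : nat) (c : G) : {mvpoly Cur[1]} :=
  ((- 'X_0) ^+ i * (del + 'X_0) ^+ j) *: (cur_in c)%:V.

Let termD i j : {morph term i j : a b / a + b}.
Proof. by move=> a b; rewrite /term cur_inD mvpolyCD scalerDr. Qed.

Let inner i a (v : Cur) := uext (fun j b => term i j (lie a b)) v.

Let innerDr i a : {morph inner i a : u v / u + v}.
Proof. by apply: uextD => j b b'; rewrite lieDr termD. Qed.

Let innerU i a j b : inner i a (upolyU j b) = term i j (lie a b).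
Proof. by rewrite /inner uextU // => k c c'; rewrite lieDr termD. Qed.

Let innerDl i v : {morph (fun a => inner i a v) : a b / a + b}.
Proof.
move=> a b /=; elim/upoly_ind: v => [|u v IHu IHv|k w].
- by rewrite !(morphD0 (innerDr _ _)) addr0.
- by rewrite !innerDr IHu IHv addrACA.
by rewrite !innerU lieDl termD.
Qed.

Let brDl v : {morph cur_br^~ v : u u' / u + u'}.
Proof. exact: uextD (fun i => innerDl i v). Qed.

Let brU i a v : cur_br (upolyU i a) v = inner i a v.
Proof. exact: uextU (fun i => innerDl i v) i a. Qed.

Let brDr u : {morph cur_br u : v v' / v + v'}.
Proof.
move=> v v'; elim/upoly_ind: u => [|u w IHu IHw|i a].
- by rewrite !(morphD0 (brDl _)) addr0.
- by rewrite !(brDl _ u w) IHu IHw addrACA.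
by rewrite !brU innerDr.
Qed.

Let brUU i a j b : cur_br (upolyU i a) (upolyU j b) = term i j (lie a b).
Proof. by rewrite brU innerU. Qed.

Let scale_l (p : {poly K}) (t : {mpoly {poly K}[1]}) :
  (forall i a j b, cur_br (p *: upolyU i a) (upolyU j b) =
    t *: cur_br (upolyU i a) (upolyU j b)) ->
  forall u v, cur_br (p *: u) v = t *: cur_br u v.
Proof.
move=> ptU u v; elim/upoly_ind: u => [|u w IHu IHw|i a].
- by rewrite scaler0 !(morphD0 (brDl _)) scaler0.
- by rewrite scalerDr (brDl _ (p *: u)) (brDl _ u w) IHu IHw scalerDr.
elim/upoly_ind: v => [|v w IHv IHw|j b]; last exact: ptU.
- by rewrite !(morphD0 (brDr _)) scaler0.
by rewrite !(brDr _ v w) IHv IHw scalerDr.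
Qed.

Let scale_r (p : {poly K}) (t : {mpoly {poly K}[1]}) :
  (forall i a j b, cur_br (upolyU i a) (p *: upolyU j b) =
    t *: cur_br (upolyU i a) (upolyU j b)) ->
  forall u v, cur_br u (p *: v) = t *: cur_br u v.
Proof.
move=> ptU u v; elim/upoly_ind: u => [|u w IHu IHw|i a].
- by rewrite !(morphD0 (brDl _)) scaler0.
- by rewrite !(brDl _ u w) IHu IHw scalerDr.
elim/upoly_ind: v => [|v w IHv IHw|j b]; last exact: ptU.
- by rewrite scaler0 !(morphD0 (brDr _)) scaler0.
by rewrite scalerDr (brDr _ (p *: v)) (brDr _ v w) IHv IHw scalerDr.
Qed.

Let termZ c i j a : term i j (c *: a) = c%:P%:MP *: term i j a.
Proof.
by rewrite /term /cur_in -upoly_scaleC mvpolyCZ !scalerA mulrC.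
Qed.

Let brZl (c : K) u v : cur_br (c%:P *: u) v = c%:P%:MP *: cur_br u v.
Proof. by apply: scale_l => i a j b; rewrite upoly_scaleC !brUU lieZl termZ. Qed.

Let brZr (c : K) u v : cur_br u (c%:P *: v) = c%:P%:MP *: cur_br u v.
Proof. by apply: scale_r => i a j b; rewrite upoly_scaleC !brUU lieZr termZ. Qed.

Let brXl u v : cur_br ('X *: u) v = - 'X_0 *: cur_br u v.
Proof.
by apply: scale_l => i a j b; rewrite upoly_scaleX !brUU /term scalerA mulrA exprS.
Qed.

Let brXr u v : cur_br u ('X *: v) = (del + 'X_0) *: cur_br u v.
Proof.
by apply: scale_r => i a j b; rewrite upoly_scaleX !brUU /term scalerA mulrCA exprS.
Qed.

Lemma cur_brE a b : cur_br (cur_in a) (cur_in b) = (cur_in (lie a b))%:V.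
Proof. by rewrite brUU /term mulr1 scale1r. Qed.

Let gen (Q : Cur -> Prop) : (forall a b, Q a -> Q b -> Q (a + b)) ->
  (forall c a, Q a -> Q (c%:P *: a)) -> (forall a, Q a -> Q ('X *: a)) ->
  (forall u, (exists a, u = cur_in a) -> Q u) -> forall u, Q u.
Proof.
move=> QD QZ QX Qin; elim/upoly_ind => [|//|i a].
  by rewrite -(morphD0 cur_inD); apply: Qin; exists 0.
elim: i => [|i IHi]; first by apply: Qin; exists a.
by rewrite -upoly_scaleX; apply: QX.
Qed.

Let brS u v : lbr_skew_at cur_br u v.
Proof.
apply: (lbr_skew_gen brDl brDr brZl brZr brXl brXr gen) => _ _ [a ->] [b ->].
rewrite /lbr_skew_at !cur_brE msubstC lieC.
by rewrite (morphDN cur_inD) (morphDN (@mvpolyCD _ _ _)).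
Qed.

Let brJ u v w : lbr_jacobi_at cur_br u v w.
Proof.
apply: (lbr_jacobi_gen brDl brDr brZl brZr brXl brXr gen) => _ _ _ [a ->] [b ->] [c ->].
have br2 s x y : lext cur_br s (cur_in x)%:V (cur_in y)%:V =
    (cur_in (lie x y))%:V :> {mvpoly Cur[2]}.
  by rewrite (lextCC brDl brDr) cur_brE msubstC.
by rewrite /lbr_jacobi_at /= !br2 lie_leibniz cur_inD mvpolyCD.
Qed.

HB.instance Definition _ := isLieConformal.Build K Cur
  brDl brDr brZl brZr brXl brXr brS brJ.

End Cur.

Section ConformalMaps.
Variables (K : fieldType) (R : lieConformalType K).

Local Open Scope classical_set_scope.

Definition gc : set (R -> {mvpoly R[1]}) :=
  [set phi | [/\ forall a b, phi (a + b) = phi a + phi b,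
                 forall (c : K) a, phi (c%:P *: a) = c%:P%:MP *: phi a &
                 forall a, phi ('X *: a) = (del + 'X_0) *: phi a]].

Definition ad (a : R) : R -> {mvpoly R[1]} := lbr a.

Definition CInn : set (R -> {mvpoly R[1]}) := [set ad a | a in setT].

Local Notation "[| u , v |]_ s" := (lext lbr s u v)
  (at level 0, u, v at level 99, s at level 0).

Definition CTDer : set (R -> {mvpoly R[1]}) :=
  [set phi | gc phi /\ forall a b c : R,
    let la : {mpoly {poly K}[3]} := 'X_0 in
    let mu : {mpoly {poly K}[3]} := 'X_1 in
    let x : {mpoly {poly K}[3]} := 'X_2 in
    let phix := cext phi x in
    phix [| [| a%:V, b%:V |]_la, c%:V |]_(la + mu) =
    [| [| phix a%:V, b%:V |]_(la + x), c%:V |]_(la + mu + x) +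
    [| [| a%:V, phix b%:V |]_la, c%:V |]_(la + mu + x) +
    [| [| a%:V, b%:V |]_la, phix c%:V |]_(la + mu)].

End ConformalMaps.

Arguments gc {K} R.
Arguments CInn {K} R.
Arguments CTDer {K} R.

(* Main.v *)
(* Setting del = d and x_i = t_i turns an element of R[x_1, ..., x_n] into a
   scalar (R = Vir) or an element of G (R = Cur G); these values separate
   elements, and a conformal map phi becomes a polynomial family of linear maps
   Phi_x(d).
   For Vir, Phi_x(d) is a scalar F_x(d), and the triple identity at the points
   where one of its factors vanishes gives F_x(2t + 2x) = 2 F_x(t), so that F_x(d)
   is a multiple of d + 2x.
   For Cur G the triple identity is
     Phi_x(y1 + y2 + y3 + 2x)[[a,b],c]
       = [[Phi_x(y1)a,b],c] + [[a,Phi_x(y2)b],c] + [[a,b],Phi_x(y3)c].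
   Hence Phi_x is affine in d, its slope is in the centroid of G, thus a scalar
   f(x), and Phi_x(0) - x f(x) is a triple derivation of G, thus inner by
   nondegeneracy of the Killing form. *)
Require Import Defs.
From HB Require Import structures.
From mathcomp Require Import all_boot all_order all_algebra finmap spectral.
From mathcomp Require Import boolp classical_sets reals complex.
From mathcomp Require Import -(notations) monalg.
From mathcomp Require Import mpoly.
From mathcomp Require Import ring.

Set Implicit Arguments.
Unset Strict Implicit.
Unset Printing Implicit Defensive.

Import GRing.Theory Num.Theory VectorInternalTheory.

Local Open Scope ring_scope.

(** * Primary decomposition *)

Lemma coprimep_expXsubC (K : fieldType) (s : seq K) (a : K) m : a \notin s ->
  coprimep (('X - a%:P) ^+ m) (\prod_(b <- s) ('X - b%:P) ^+ m).
Proof.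
elim: s => [|b s IHs]; first by rewrite big_nil coprimep1.
rewrite inE negb_or big_cons coprimepMr => /andP [ab /IHs ->]; rewrite andbT.
apply: coprimep_expl; apply: coprimep_expr.
by rewrite coprimep_XsubC root_XsubC eq_sym ab.
Qed.

(** Chinese remaindering: a polynomial in a matrix can then act as the prescribed scalar [c a] on
    each generalized eigenspace. *)
Lemma poly_crt (K : fieldType) (s : seq K) (c : K -> K) m :
  exists q, {in s, forall a, ('X - a%:P) ^+ m %| q - (c a)%:P}.
Proof.
elim: s => [|a s [q qs]]; first by exists 0.
have [as_|as_] := boolP (a \in s).
  by exists q => b; rewrite inE => /predU1P [->|]; apply: qs.
have /Bezout_coprimepP [[u v] /= /eqpP [[k l] /= /andP [k0 l0]]] :=
  coprimep_expXsubC m as_.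
set A := _ ^+ m; set P := \prod_(_ <- _) _ => klP.
have uv1 : (k / l) *: (u * A + v * P) = 1.
  by rewrite mulrC -scalerA klP scalerA mulVf // scale1r.
(* The Bezout term in [P] is 1 modulo [A] and 0 modulo every factor of [P], so the correction
   changes [q] only at [a]. *)
exists (q + ((c a)%:P - q) * ((k / l) *: v * P)) => b.
rewrite inE => /predU1P [->|bs].
  have -> : (k / l) *: v * P = 1 - (k / l) *: u * A.
    by rewrite -uv1 scalerDr -!scalerAl [X in _ = X - _]addrC addrK.
  rewrite mulrBr mulr1 addrA [q + _]addrC subrK addrAC subrr add0r mulrA -mulNr.
  exact: dvdp_mull.
rewrite addrAC dvdp_add ?qs // mulrA dvdp_mull // /P (big_rem b) //=.
exact: dvdp_mulr.
Qed.

Section Primary.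
Variables (K : fieldType) (n : nat) (X : 'M[K]_n.+1).
Implicit Types (u v : 'rV[K]_n.+1) (p q : {poly K}).

Lemma mul_horner_dvdp p q u : u *m horner_mx X p = 0 -> p %| q ->
  u *m horner_mx X q = 0.
Proof.
move=> up /dvdpP [r ->]; rewrite mulrC rmorphM /= -mulmxE mulmxA up.
exact: mul0mx.
Qed.

(** The primary decomposition as an induction principle: by Bezout, a vector killed by the product
    is a sum of vectors each killed by one factor. *)
Lemma primary_ind (s : seq K) m (Q : 'rV[K]_n.+1 -> Prop) :
  Q 0 -> (forall u v, Q u -> Q v -> Q (u + v)) ->
  (forall a u, a \in s -> u *m horner_mx X (('X - a%:P) ^+ m) = 0 -> Q u) ->
  uniq s -> forall u, u *m horner_mx X (\prod_(a <- s) ('X - a%:P) ^+ m) = 0 -> Q u.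
Proof.
move=> Q0 QD; elim: s => [|a s IHs] Qs /=.
  by move=> _ u; rewrite big_nil rmorph1 mulmx1 => ->.
case/andP => as_ us u; rewrite big_cons => uAP.
have /Bezout_coprimepP [[v w] /= /eqpP [[k l] /= /andP [k0 l0]]] :=
  coprimep_expXsubC m as_.
move: uAP; set A := _ ^+ m; set P := \prod_(_ <- _) _ => uAP klP.
have vw1 : (k / l) *: (v * A + w * P) = 1.
  by rewrite mulrC -scalerA klP scalerA mulVf // scale1r.
rewrite -[u]mulmx1 idmxE -(rmorph1 (horner_mx X)) -vw1 scalerDr rmorphD /= mulmxDr.
apply: QD.
  apply: IHs => // [b u' bs|]; first by apply: Qs; rewrite inE bs orbT.
  rewrite -mulmxA mulmxE -rmorphM /=.
  apply: mul_horner_dvdp uAP _; rewrite -scalerAl -mulrA.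
  by rewrite dvdpZr ?mulf_neq0 ?invr_eq0 // dvdp_mull.
apply: (Qs a); first by rewrite inE eqxx.
rewrite -mulmxA mulmxE -rmorphM /=.
apply: mul_horner_dvdp uAP _; rewrite -scalerAl -mulrA [P * A]mulrC.
by rewrite dvdpZr ?mulf_neq0 ?invr_eq0 // dvdp_mull.
Qed.

Variable B : 'rV[K]_n.+1 -> 'rV[K]_n.+1 -> 'rV[K]_n.+1.
Hypothesis BDl : forall v, {morph B^~ v : u u' / u + u'}.
Hypothesis BDr : forall u, {morph B u : v v' / v + v'}.
Hypothesis BZl : forall a u v, B (a *: u) v = a *: B u v.
Hypothesis BZr : forall a u v, B u (a *: v) = a *: B u v.

(** [X - (a + b)] acts on [B u v] as [X - a] on [u] plus [X - b] on [v]. Each term lowers [i + j],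
    and an argument with exponent 0 is itself 0. *)
Lemma primary_derivation a b i j u v :
  (forall u v, B u v *m X = B (u *m X) v + B u (v *m X)) ->
  u *m horner_mx X (('X - a%:P) ^+ i) = 0 ->
  v *m horner_mx X (('X - b%:P) ^+ j) = 0 ->
  B u v *m horner_mx X (('X - (a + b)%:P) ^+ (i + j)) = 0.
Proof.
move=> BX; move: {2}(i + j)%N (erefl (i + j)%N) => k.
have B0l w : B 0 w = 0 by have := BZl 0 0 w; rewrite !scale0r.
have B0r w : B w 0 = 0 by have := BZr 0 w 0; rewrite !scale0r.
elim: k i j u v => [|k IHk] i j u v ijk.
  have /eqP -> : i == 0%N by move/eqP: ijk; rewrite addn_eq0 => /andP [].
  by rewrite expr0 rmorph1 mulmx1 => -> _; rewrite B0l mul0mx.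
case: i ijk => [|i] ijk.
  by rewrite expr0 rmorph1 mulmx1 => ->; rewrite B0l mul0mx.
case: j ijk => [|j] ijk ui vj.
  by move: vj; rewrite expr0 rmorph1 mulmx1 => ->; rewrite B0r mul0mx.
have hX c w l : w *m horner_mx X (('X - c%:P) ^+ l.+1) =
    (w *m X - c *: w) *m horner_mx X (('X - c%:P) ^+ l).
  rewrite exprS rmorphM /= -mulmxE mulmxA rmorphB /= horner_mx_X horner_mx_C.
  by rewrite mulmxBr mul_mx_scalar.
rewrite addSn hX BX.
have -> : B (u *m X) v + B u (v *m X) - (a + b) *: B u v =
    B (u *m X - a *: u) v + B u (v *m X - b *: v).
  by rewrite (BDl v) BDr -!scaleN1r !BZl !BZr scalerDl scalerDr -addrACA.
rewrite mulmxDl {1}IHk ?add0r -?hX //; last by move: ijk; rewrite addSn => -[].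
rewrite addnS -addSn IHk //; first by move: ijk; rewrite addnS => -[].
by rewrite -hX.
Qed.

End Primary.

(** Gives the trace of a polynomial in a triangularized matrix as a sum over its eigenvalues. *)
Lemma trig_horner (K : fieldType) n (T : 'M[K]_n.+1) p : is_trig_mx T ->
  is_trig_mx (horner_mx T p) /\ forall i, horner_mx T p i i = p.[T i i].
Proof.
move=> /is_trig_mxP T0; elim/poly_ind: p => [|p c [/is_trig_mxP p0 pE]].
  by rewrite rmorph0; split=> [|i]; rewrite ?mx0_is_trig // mxE horner0.
rewrite rmorphD rmorphM /= horner_mx_X horner_mx_C; split=> [|i].
  apply/is_trig_mxP => i j ij; rewrite !mxE big1 => [|k _].
    by rewrite (negbTE (_ : i != j)) ?mulr0n ?addr0 // -val_eqE ltn_eqF.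
  have [ik|ki] := ltnP i k; first by rewrite p0 ?mul0r.
  by rewrite T0 ?mulr0 // (leq_ltn_trans ki).
rewrite !mxE eqxx mulr1n (bigD1 i) //= big1 => [|k ki].
  by rewrite addr0 pE hornerMXaddC.
case: (ltngtP i k) => [ik|ik|/val_inj ik]; first by rewrite p0 ?mul0r.
  by rewrite T0 ?mulr0.
by rewrite ik eqxx in ki.
Qed.

(** Replaces the characteristic polynomial by a multiple whose distinct factors carry one common
    exponent, the form that [primary_ind] takes. *)
Lemma dvdp_prod_undup (K : fieldType) (r : seq K) :
  \prod_(a <- r) ('X - a%:P) %| \prod_(a <- undup r) ('X - a%:P) ^+ size r.
Proof.
rewrite -prodr_undup_exp_count; elim/big_ind2: _ => // [p p' q q'|a _].
  exact: dvdp_mul.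
by apply: dvdp_exp2l; apply: count_size.
Qed.

(* If X has semisimple part S, with eigenvalues a, take for Y the map with the
   eigenvalues of S replaced by their conjugates. It is again a derivation
   because conjugation is additive, and tr(X Y) is the sum of the |a|^2. *)
Lemma conjugate_semisimple_part (K : numClosedFieldType) n (X : 'M[K]_n) :
  exists Y : 'M[K]_n,
    (forall B : 'rV[K]_n -> 'rV[K]_n -> 'rV[K]_n,
       (forall v, {morph B^~ v : u u' / u + u'}) ->
       (forall u, {morph B u : v v' / v + v'}) ->
       (forall a u v, B (a *: u) v = a *: B u v) ->
       (forall a u v, B u (a *: v) = a *: B u v) ->
       (forall u v, B u v *m X = B (u *m X) v + B u (v *m X)) ->
       forall u v, B u v *m Y = B (u *m Y) v + B u (v *m Y)) /\
    (\tr (X *m Y) = 0 -> exists k, X ^+ k = 0).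
Proof.
case: n X => [|n] X.
  exists 0; split=> [B _ _ _ _ _ u v|_]; first by rewrite !thinmx0.
  by exists 0%N; apply: flatmx0.
have [P Pu Ttrig] := Schur X (ltn0Sn n).
move/unitarymx_unit: Pu => Pu.
set T := conjmx P X in Ttrig.
have hT p : horner_mx X p = invmx P *m horner_mx T p *m P.
  rewrite /T horner_mx_conj ?row_free_unit ?stablemx_unit //.
  by rewrite -conjVmx // conjmxK.
pose r := [seq T i i | i <- enum 'I_n.+1]; pose s := undup r; pose N := size r.
have cT : char_poly T = \prod_(a <- r) ('X - a%:P).
  by rewrite char_poly_trig // big_map big_enum.
have kill : horner_mx X (\prod_(a <- s) ('X - a%:P) ^+ N) = 0.
  have /dvdpP [q ->] := dvdp_prod_undup r.
  by rewrite hT rmorphM /= -cT Cayley_Hamilton mulr0 mulmx0 mul0mx.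
have killv (w : 'rV[K]_n.+1) :
  w *m horner_mx X (\prod_(a <- s) ('X - a%:P) ^+ N) = 0 by rewrite kill mulmx0.
(* For [u], [v] in the components of [a] and [b], [B u v] is killed by the power [N + N] of
   [X - (a + b)]. Hence [q] is prescribed at the sums too, which need not be eigenvalues. *)
have [q qS] := poly_crt (s ++ [seq a + b | a <- s, b <- s]) Num.conj (N + N).
have qw a (w : 'rV[K]_n.+1) : a \in s ++ [seq a + b | a <- s, b <- s] ->
    w *m horner_mx X (('X - a%:P) ^+ (N + N)) = 0 ->
    w *m horner_mx X q = Num.conj a *: w.
  move=> /qS aq wa; move/eqP: (mul_horner_dvdp wa aq).
  by rewrite rmorphB /= horner_mx_C mulmxBr mul_mx_scalar subr_eq0 => /eqP.
have qw1 a (w : 'rV[K]_n.+1) : a \in s -> w *m horner_mx X (('X - a%:P) ^+ N) = 0 ->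
    w *m horner_mx X q = Num.conj a *: w.
  move=> as_ wa; apply: qw; first by rewrite mem_cat as_.
  by apply: mul_horner_dvdp wa _; rewrite dvdp_exp2l // leq_addr.
exists (horner_mx X q); split=> [B BDl BDr BZl BZr BX u v|].
  have B0l w : B 0 w = 0 by have := BZl 0 0 w; rewrite !scale0r.
  have B0r w : B w 0 = 0 by have := BZr 0 w 0; rewrite !scale0r.
  move: u (killv u) v; apply: primary_ind; rewrite ?undup_uniq //.
  - by move=> v; rewrite !(B0l, mul0mx) addr0.
  - by move=> u u' IHu IHu' v; rewrite !(BDl, mulmxDl) IHu IHu' addrACA.
  move=> a u as_ ua v.
  move: v (killv v); apply: primary_ind; rewrite ?undup_uniq //.
  - by rewrite !(B0r, mul0mx) addr0.
  - by move=> v v' IHv IHv'; rewrite !(BDr, mulmxDl) IHv IHv' addrACA.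
  move=> b v bs vb; rewrite (qw1 a u) // (qw1 b v) // (qw (a + b)).
  - by rewrite BZl BZr -scalerDl rmorphD.
  - by rewrite mem_cat; apply/orP; right; apply/allpairsP; exists (a, b).
  exact: primary_derivation.
have -> : X *m horner_mx X q = horner_mx X ('X * q).
  by rewrite rmorphM /= horner_mx_X.
rewrite hT mxtrace_mulC mulmxA mulmxV // mul1mx /mxtrace.
have Ts i : T i i \in s.
  by rewrite mem_undup; apply/mapP; exists i; rewrite ?mem_enum.
have -> : \sum_i horner_mx T ('X * q) i i = \sum_i `|T i i| ^+ 2.
  apply: eq_bigr => i _; rewrite (trig_horner _ Ttrig).2 hornerM hornerX normCK.
  congr (_ * _); apply/eqP; rewrite -subr_eq0.
  have /qS/dvdpP [t /(congr1 (horner^~ (T i i)))] :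
    T i i \in s ++ [seq a + b | a <- s, b <- s] by rewrite mem_cat Ts.
  rewrite !hornerE /= => ->.
  by rewrite subrr expr0n /N size_map size_enum_ord mulr0.
move/eqP; rewrite psumr_eq0 => [/allP T0|i _]; last by rewrite exprn_ge0.
(* All eigenvalues vanish, so the characteristic polynomial is a power of ['X] and Cayley-Hamilton
   gives nilpotency. *)
exists n.+1; rewrite -[X](horner_mx_X X) -rmorphXn /= hT.
suff -> : 'X^(n.+1) = char_poly T by rewrite Cayley_Hamilton mulmx0 mul0mx.
rewrite char_poly_trig // -[n.+1 in LHS]card_ord -prodr_const; apply: eq_bigr => i _.
have := T0 i (mem_index_enum _); rewrite sqrf_eq0 normr_eq0 => /eqP ->.
by rewrite subr0.
Qed.

(** * Simple Lie algebras *)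

Section LieGeneral.
Variables (K : fieldType) (G : vectLieAlgType K).
Implicit Types (x y z : G) (U V W : {vspace G}) (f g : 'End(G)).

HB.instance Definition _ x := GRing.isLinear.Build K G G _ (lie x) (lie_linearr x).

Lemma lieNl x y : lie (- x) y = - lie x y.
Proof. by rewrite -scaleN1r lieZl scaleN1r. Qed.

Lemma lieNr x y : lie x (- y) = - lie x y.
Proof. by rewrite -scaleN1r lieZr scaleN1r. Qed.

(* Engel: the subalgebras k with this property are enlarged one dimension at a
   time, the property for U = k and W = G giving a normalizing vector. *)
Lemma engel_flag n :
  (forall x y, exists m, iter m (lie x) y = 0) -> (n <= \dim {:G})%N ->
  exists k : {vspace G}, [/\ \dim k = n,
    {in k &, forall x y, lie x y \in k} &
    forall U W, ~~ (W <= U)%VS ->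
      {in k & U, forall x u, lie x u \in U} ->
      {in k & W, forall x w, lie x w \in W} ->
      exists v, [/\ v \in W, v \notin U & {in k, forall x, lie x v \in U}]].
Proof.
move=> nil; elim: n => [_|n IHn ltn].
  exists 0%VS; rewrite dimv0; split=> // [x y|U W /subvPn [v vW vU] _ _].
    by rewrite memv0 => /eqP -> _; rewrite lie0l mem0v.
  by exists v; split=> // x; rewrite memv0 => /eqP ->; rewrite lie0l mem0v.
have [k [dimk kk kUW]] := IHn (ltnW ltn).
have [|||y [_ yk ky]] := kUW k fullv.
- by apply/negP => /dimvS; rewrite dimk leqNgt ltn.
- by move=> x w xk wk; apply: kk.
- by move=> x w _ _; rewrite memvf.
have mem_k' x : x \in (k + <[y]>)%VS ->
    exists2 a, a \in k & exists c, x = a + c *: y.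
  by case/memv_addP => a ak [_ /vlineP [c ->] ->]; exists a => //; exists c.
exists (k + <[y]>)%VS; split.
- rewrite dimv_disjoint_sum ?dimk ?dim_vline.
    by case: eqP yk => [->|_ _]; rewrite ?mem0v // addn1.
  apply/eqP; rewrite -subv0; apply/subvP => x; rewrite memv_cap memv0.
  case/andP => xk /vlineP [c xc]; move: xk; rewrite xc.
  have [->|c0] := eqVneq c 0; first by rewrite scale0r.
  move=> cyk; case/negP: yk.
  by rewrite -[y]scale1r -(mulVf c0) -scalerA rpredZ.
- move=> _ _ /mem_k' [a ak [c ->]] /mem_k' [b bk [d ->]].
  rewrite lieDl !lieDr !lieZl !lieZr lie_alt !scaler0 addr0 (lieC y b).
  apply: (subvP (addvSl _ _)).
  by rewrite !rpredD ?rpredZ ?rpredN ?(ky _ ak) ?(ky _ bk) ?kk.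
move=> U W WU k'U k'W.
have sk : (k <= k + <[y]>)%VS by apply: addvSl.
have yk' : y \in (k + <[y]>)%VS by apply: (subvP (addvSr _ _)); apply: memv_line.
have [||v [vW vU kv]] := kUW U W WU.
- by move=> x u xk uU; rewrite k'U // (subvP sk).
- by move=> x u xk uU; rewrite k'W // (subvP sk).
(* Since [y] normalizes [k], the Leibniz rule keeps the iterates of [ad y] on [v] among the vectors
   of [W] that [k] sends into [U]. *)
have iterP j : iter j (lie y) v \in W /\
    {in k, forall x, lie x (iter j (lie y) v) \in U}.
  elim: j => [|j [IHW IHU]] //=; split=> [|x xk]; first by rewrite k'W.
  by rewrite lie_leibniz rpredD ?IHU ?ky // k'U // IHU.
have [m ymv] := nil y v.
have exm : exists m, iter m (lie y) v \in U by exists m; rewrite ymv mem0v.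
(* The iterate just before the first one in [U] is sent into [U] by [y] as well. *)
have [[|j] jU minj] :=
  @ex_minnP (fun i => iter i (lie y) v \in U) exm; first by rewrite jU in vU.
exists (iter j (lie y) v); case: (iterP j) => jW kjU; split=> //.
  by apply/negP => /minj; rewrite ltnn.
move=> _ /mem_k' [a ak [c ->]]; rewrite lieDl lieZl rpredD ?rpredZ //; exact: kjU.
Qed.

Hypothesis simpleG : lie_simple G.

Lemma simple_ideal (I : {vspace G}) : (forall x y, y \in I -> lie x y \in I) ->
  (exists2 x, x \in I & x != 0) -> I = fullv.
Proof.
move=> idI [x xI x0].
have [I0|//] := simpleG.2 I idI.
by move: xI; rewrite I0 memv0 (negbTE x0).
Qed.

(** The line through a nonzero central element would be an ideal, hence all of [G], and [G] would be
    abelian. *)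
Lemma simple_center z : (forall x, lie x z = 0) -> z = 0.
Proof.
move=> zc; apply/eqP/negP => /negP z0.
have zG : <[z]>%VS = fullv.
  apply: simple_ideal => [x y /vlineP [c ->]|]; last by exists z; rewrite ?memv_line.
  by rewrite lieZr zc scaler0 mem0v.
have [x [y /eqP]] := simpleG.1; apply.
have /vlineP [c ->] : y \in <[z]>%VS by rewrite zG memvf.
by rewrite lieZr zc scaler0.
Qed.

(** Engel's flag at full dimension, with [U = 0] and [W = G], would yield a nonzero central
    vector. *)
Lemma simple_not_nil : ~ forall x y, exists m, iter m (lie x) y = 0.
Proof.
move=> nil; have [k [dimk _ kUW]] := engel_flag nil (leqnn _).
have kG : k = fullv by apply/eqP; rewrite eqEdim subvf dimk leqnn.
have [|||v [_ v0 kv]] := kUW 0%VS fullv.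
- have [x [y xy0]] := simpleG.1; apply/subvPn.
  by exists (lie x y); rewrite ?memvf ?memv0.
- by move=> x u _; rewrite memv0 => /eqP ->; rewrite lie0r mem0v.
- by move=> x w _ _; rewrite memvf.
case/negP: v0; rewrite memv0; apply/eqP; apply: simple_center => x.
by apply/eqP; rewrite -memv0 kv // kG memvf.
Qed.

(** The brackets span a nonzero ideal, hence [G]. Additivity of [Q] suffices because a scalar can be
    moved inside a bracket. *)
Lemma simple_perfect (Q : G -> Prop) :
  (forall x y, Q x -> Q y -> Q (x + y)) -> (forall x y, Q (lie x y)) ->
  forall x, Q x.
Proof.
move=> QD Qlie x.
pose b := vbasis {:G}; pose X := [seq lie u v | u <- b, v <- b].
have sG y : y \in <<b>>%VS by rewrite (span_basis (vbasisP _)) memvf.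
have lieX y z : lie y z \in <<X>>%VS.
  have lieXb u : u \in b -> lie u z \in <<X>>%VS.
    move=> ub; rewrite (coord_span (sG z)) linear_sum rpred_sum // => i _.
    rewrite linearZ rpredZ // memv_span //; apply/allpairsP.
    by exists (u, b`_i); rewrite mem_nth ?size_tuple.
  rewrite (coord_span (sG y)) lieC linear_sum -sumrN rpred_sum // => i _.
  by rewrite linearZ -scalerN -lieC rpredZ // lieXb // mem_nth ?size_tuple.
have XG : <<X>>%VS = fullv.
  have [y [z yz0]] := simpleG.1.
  by apply: simple_ideal => [y' z' _|]; [apply: lieX | exists (lie y z)].
have xX : x \in <<in_tuple X>>%VS by rewrite XG memvf.
rewrite (coord_span xX); elim/big_ind: _ => [||i _].
- by rewrite -(lie0l 0); apply: Qlie.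
- exact: QD.
have /allpairsP [[u v] [_ _ ->]] : (in_tuple X)`_i \in X by rewrite mem_nth.
by rewrite -lieZl; apply: Qlie.
Qed.

End LieGeneral.

(** * The trace form on endomorphisms and the adjoint representation *)

Section KillingForm.
Variables (K : fieldType) (G : vectLieAlgType K).
Implicit Types (x y z : G) (f g h : 'End(G)).

Lemma v2r_lfun f x : v2r (f x) = v2r x *m f2mx f.
Proof. by rewrite unlock /= r2vK. Qed.

Lemma f2mx_comp f g : f2mx (f \o g)%VF = f2mx g *m f2mx f.
Proof.
apply/mul_rVP => u; rewrite mulmxA -[u]r2vK -!v2r_lfun.
by rewrite comp_lfunE.
Qed.

Definition lfun_tr f : K := \tr (f2mx f).

Lemma lfun_tr_comp f g : lfun_tr (f \o g)%VF = lfun_tr (g \o f)%VF.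
Proof. by rewrite /lfun_tr !f2mx_comp mxtrace_mulC. Qed.

Lemma lfun_trD f g : lfun_tr (f + g) = lfun_tr f + lfun_tr g.
Proof.
rewrite /lfun_tr -mxtraceD; congr (\tr _); apply/mul_rVP => u.
by rewrite mulmxDr -[u]r2vK -!v2r_lfun add_lfunE linearD.
Qed.

Lemma lfun_trZ a f : lfun_tr (a *: f) = a * lfun_tr f.
Proof.
rewrite /lfun_tr -mxtraceZ; congr (\tr _); apply/mul_rVP => u.
by rewrite -scalemxAr -[u]r2vK -!v2r_lfun scale_lfunE linearZ.
Qed.

Lemma lfun_trB f g : lfun_tr (f - g) = lfun_tr f - lfun_tr g.
Proof. by rewrite lfun_trD -scaleN1r lfun_trZ mulN1r. Qed.

Definition lfun_ad x : 'End(G) := linfun (lie x).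

Lemma lfun_adE x y : lfun_ad x y = lie x y.
Proof. exact: lfunE. Qed.

Lemma lfun_ad_linear : linear lfun_ad.
Proof.
move=> a x y; apply/lfunP => z.
by rewrite add_lfunE scale_lfunE !lfun_adE lieDl lieZl.
Qed.

HB.instance Definition _ :=
  GRing.isLinear.Build K G 'End(G) _ lfun_ad lfun_ad_linear.

Lemma lfun_ad_lie x y :
  lfun_ad (lie x y) = (lfun_ad x \o lfun_ad y)%VF - (lfun_ad y \o lfun_ad x)%VF.
Proof.
apply/lfunP => z; rewrite add_lfunE opp_lfunE !comp_lfunE !lfun_adE.
by rewrite lie_leibniz addrK.
Qed.

(** Invariance of the trace form, from cyclicity of the trace. *)
Lemma lfun_tr_invariant f g h :
  lfun_tr (((f \o g) - (g \o f)) \o h)%VF = lfun_tr (f \o ((g \o h) - (h \o g)))%VF.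
Proof.
rewrite comp_lfunDl comp_lfunDr comp_lfunNl comp_lfunNr !lfun_trB.
by rewrite -!comp_lfunA [lfun_tr (g \o _)]lfun_tr_comp -!comp_lfunA.
Qed.

(** The functional sending [y] to the trace of [f] with [ad y], recorded by its values on a basis so
    that dimensions can be compared. *)
Definition killing_row f : 'rV[K]_(\dim {:G}) :=
  \row_i lfun_tr (f \o lfun_ad (vbasis {:G})`_i)%VF.

Lemma killing_row_linear : linear killing_row.
Proof.
move=> a f g; apply/rowP => i; rewrite !mxE comp_lfunDl lfun_trD -lfun_trZ.
by rewrite comp_lfunZl.
Qed.

HB.instance Definition _ :=
  GRing.isLinear.Build K 'End(G) _ _ killing_row killing_row_linear.

Lemma killing_rowP f :
  killing_row f = 0 <-> forall y, lfun_tr (f \o lfun_ad y)%VF = 0.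
Proof.
split=> [f0 y|f0]; last by apply/rowP => i; rewrite !mxE f0.
rewrite [y](coord_vbasis (memvf y)) linear_sum /=.
elim/big_ind: _ => [||i _].
- by rewrite comp_lfun0r -(scale0r (0 : 'End(G))) lfun_trZ mul0r.
- by move=> g h g0 h0; rewrite comp_lfunDr lfun_trD g0 h0 addr0.
rewrite linearZ /= -comp_lfunZr lfun_trZ; move/rowP/(_ i): f0; rewrite !mxE.
by move=> ->; rewrite mulr0.
Qed.

End KillingForm.

(** * Killing form, centroid and triple derivations of a simple Lie algebra *)

Section SimpleLie.
Variables (K : numClosedFieldType) (G : vectLieAlgType K).
Implicit Types (x y z : G) (f g h T : 'End(G)).
Hypothesis simpleG : lie_simple G.

(** Cartan's criterion. The conjugated semisimple part [S] of [ad x] is a derivation, so the trace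
    of [ad [a,b]] with [S] is minus that of [ad a] with [ad (S b)], hence 0. As [G] is perfect, the
    trace of [ad x] with [S] is 0 too, and [ad x] is nilpotent for every [x], which simplicity
    excludes. *)
Lemma killing_nonzero : ~ forall x y, lfun_tr (lfun_ad x \o lfun_ad y)%VF = 0.
Proof.
move=> kill0; apply: (simple_not_nil simpleG) => x y.
have [Y [derY nilX]] := conjugate_semisimple_part (f2mx (lfun_ad x)).
pose S : 'End(G) := Hom Y.
have SE u : v2r (S u) = v2r u *m Y by rewrite v2r_lfun.
have derS a b : S (lie a b) = lie (S a) b + lie a (S b).
  apply: (can_inj v2rK); rewrite linearD /= SE.
  (* The bracket is transported to coordinate rows, where the Jacobi identity makes [ad x] a
     derivation. *)
  have := derY (fun u v => v2r (lie (r2v u) (r2v v))) _ _ _ _ _ (v2r a) (v2r b).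
  rewrite /= !v2rK -!SE !v2rK; apply.
  - by move=> v u u'; rewrite !linearD lieDl linearD.
  - by move=> u v v'; rewrite !linearD.
  - by move=> c u v; rewrite !linearZ /= lieZl linearZ.
  - by move=> c u v; rewrite !linearZ.
  move=> u v; rewrite -v2r_lfun -[u in RHS]r2vK -[v in RHS]r2vK -!v2r_lfun !v2rK.
  by rewrite -linearD !lfun_adE lie_leibniz.
have trS z : lfun_tr (lfun_ad z \o S)%VF = 0.
  apply: (simple_perfect simpleG (Q := fun z => lfun_tr (lfun_ad z \o S)%VF = 0)).
    move=> u v u0 v0; rewrite linearD /=.
    by rewrite comp_lfunDl lfun_trD u0 v0 addr0.
  move=> a b; rewrite lfun_ad_lie lfun_tr_invariant.
  have -> : ((lfun_ad b \o S) - (S \o lfun_ad b))%VF = - lfun_ad (S b).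
    apply/lfunP => c; rewrite add_lfunE !opp_lfunE !comp_lfunE !lfun_adE derS.
    by rewrite opprD addrCA subrr addr0.
  by rewrite comp_lfunNr -scaleN1r lfun_trZ kill0 mulr0.
have [|k Xk] := nilX.
  by have := trS x; rewrite lfun_tr_comp /lfun_tr f2mx_comp.
exists k; apply: (can_inj v2rK); rewrite linear0.
suff -> : v2r (iter k (lie x) y) = v2r y *m f2mx (lfun_ad x) ^+ k.
  by rewrite Xk mulmx0.
elim: k {Xk} => [|k IHk]; first by rewrite expr0 mulmx1.
by rewrite iterS -lfun_adE v2r_lfun IHk exprSr -mulmxE mulmxA.
Qed.

(** By invariance the radical of the Killing form is an ideal; were it nonzero, it would be [G] and
    the form would vanish. *)
Lemma killing_nondegenerate x :
  (forall y, lfun_tr (lfun_ad x \o lfun_ad y)%VF = 0) -> x = 0.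
Proof.
move=> x0.
pose kr := linfun (@killing_row K G \o @lfun_ad K G).
have kerP z : z \in lker kr <->
    forall y, lfun_tr (lfun_ad z \o lfun_ad y)%VF = 0.
  by rewrite memv_ker lfunE /= -(rwP eqP); apply: killing_rowP.
apply/eqP/negP => /negP nx0.
have kerG : lker kr = fullv.
  apply: (simple_ideal simpleG) => [y z /kerP z0|]; last by exists x => //; apply/kerP.
  apply/kerP => w; rewrite lieC -scaleN1r linearZ /= -comp_lfunZl lfun_trZ.
  by rewrite lfun_ad_lie lfun_tr_invariant -lfun_ad_lie z0 mulr0.
by apply: killing_nonzero => y; apply/kerP; rewrite kerG memvf.
Qed.

(** By nondegeneracy the map from [z] to the trace functional of [ad z] is injective, hence onto by
    dimension. *)
Lemma killing_represents T :
  exists z, forall y, lfun_tr ((T - lfun_ad z) \o lfun_ad y)%VF = 0.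
Proof.
pose kr := linfun (@killing_row K G \o @lfun_ad K G).
have ker0 : lker kr == 0%VS.
  rewrite -subv0; apply/subvP => z; rewrite memv_ker lfunE /= => /eqP z0.
  by rewrite memv0; apply/eqP/killing_nondegenerate/killing_rowP.
have : killing_row T \in limg kr.
  suff -> : limg kr = fullv by rewrite memvf.
  apply/eqP; rewrite eqEdim subvf limg_dim_eq; last by rewrite (eqP ker0) capv0.
  by rewrite dimvf /dim /= mul1n.
case/memv_imgP => z _; rewrite lfunE /= => Tz; exists z; apply/killing_rowP.
by rewrite linearB /= Tz subrr.
Qed.

(** Schur's lemma: [T] has an eigenvector over an algebraically closed field, and its eigenspace is
    an ideal. *)
Lemma centroid_scalar T : (forall x y, T (lie x y) = lie x (T y)) ->
  exists c, forall x, T x = c *: x.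
Proof.
move=> TC.
have [a [u [u0 Tu]]] : exists a u, u != 0 /\ T u = a *: u.
  have /closed_rootP [a] : size (char_poly (f2mx T)) != 1%N.
    rewrite size_char_poly eqSS -dimvf dimv_eq0.
    have [x [y xy0]] := simpleG.1; apply/negP => /eqP G0.
    by have := memvf (lie x y); rewrite G0 memv0 (negbTE xy0).
  rewrite -eigenvalue_root_char => /eigenvalueP [v vT v0]; exists a, (r2v v).
  split; first by apply: contraNneq v0 => /(congr1 v2r); rewrite r2vK linear0 => ->.
  by apply: (can_inj v2rK); rewrite v2r_lfun linearZ /= r2vK.
exists a => x.
have kerG : lker (T - a *: \1%VF) = fullv.
  apply: (simple_ideal simpleG) => [y z|]; last first.
    by exists u => //; rewrite memv_ker !lfun_simp Tu subrr.
  by rewrite !memv_ker !lfun_simp TC -lieZr -lieNr -lieDr => /eqP ->; rewrite lie0r.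
have := memvf x; rewrite -kerG memv_ker !lfun_simp subr_eq0.
by move/eqP.
Qed.

(** Choose [z] with [E = T - ad z] orthogonal to every [ad y]. The commutator of [E] with [ad [a,b]]
    is [ad] of [[E a,b] + [a,E b]], so this element lies in the radical and is 0. Hence [E] is in
    the centroid, thus a scalar [c], and [2c [a,b] = 0]. *)
Lemma triple_derivation_inner T :
  (forall a b c, T (lie (lie a b) c) =
     lie (lie (T a) b) c + lie (lie a (T b)) c + lie (lie a b) (T c)) ->
  exists z, forall x, T x = lie z x.
Proof.
move=> derT; have [z trE] := killing_represents T.
pose E := T - lfun_ad z.
have derE a b c : E (lie (lie a b) c) =
     lie (lie (E a) b) c + lie (lie a (E b)) c + lie (lie a b) (E c).
  rewrite /E !add_lfunE !opp_lfunE !lfun_adE derT !(lieDl, lieDr, lieNl, lieNr).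
  by rewrite !(lie_leibniz z) lieDl !opprD addrACA [X in X + _ = _]addrACA.
have E0 a b : lie (E a) b + lie a (E b) = 0.
  apply: killing_nondegenerate => w.
  have -> : lfun_ad (lie (E a) b + lie a (E b)) =
      ((E \o lfun_ad (lie a b)) - (lfun_ad (lie a b) \o E))%VF.
    apply/lfunP => c; rewrite add_lfunE opp_lfunE !comp_lfunE !lfun_adE derE.
    by rewrite addrK lieDl.
  by rewrite lfun_tr_invariant -lfun_ad_lie trE.
have [c Ec] : exists c, forall x, E x = c *: x.
  apply: centroid_scalar => x y.
  move: x; apply: (simple_perfect simpleG) => [x x' IHx IHx'|a b].
    by rewrite !lieDl -[LHS]/(E _) linearD /= IHx IHx'.
  by rewrite derE -lieDl E0 lie0l add0r.
have c0 : c = 0.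
  have [a [b ab0]] := simpleG.1; move/eqP: (E0 a b).
  rewrite !Ec lieZl lieZr -scalerDl scaler_eq0 (negbTE ab0) orbF.
  by rewrite -mulr2n mulrn_eq0 /= => /eqP.
exists z => x; apply/eqP; rewrite -subr_eq0 -lfun_adE -opp_lfunE -add_lfunE.
by rewrite -/E Ec c0 scale0r.
Qed.

End SimpleLie.

(** * Evaluation of polynomials with coefficients in a C[d]-module *)

Section Evaluation.
Variables (K : fieldType) (R : lmodType {poly K}) (W : lmodType K).
Variable E : K -> R -> W.
Hypothesis ED : forall d, {morph E d : a b / a + b}.
Hypothesis EZ : forall d p a, E d (p *: a) = p.[d] *: E d a.

Definition mpev n (d : K) (x : 'I_n -> K) : {mpoly {poly K}[n]} -> K :=
  mmap (horner_eval d) x.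

HB.instance Definition _ n d (x : 'I_n -> K) := GRing.RMorphism.on (mpev d x).

Lemma mpevX n d (x : 'I_n -> K) i : mpev d x 'X_i = x i.
Proof. by rewrite /mpev mmapX mmap1U. Qed.

Lemma mpevC n d (x : 'I_n -> K) p : mpev d x p%:MP = p.[d].
Proof. by rewrite /mpev mmapC. Qed.

Lemma mpev_del n d (x : 'I_n -> K) : mpev d x del = d.
Proof. by rewrite del.unlock mpevC hornerX. Qed.

Lemma mpev_psubst n d (x : 'I_n -> K) s f : mpev d x (psubst s f) = f.[mpev d x s].
Proof.
elim/poly_ind: f => [|f c IHf]; first by rewrite /psubst rmorph0 !horner0 rmorph0.
rewrite psubstD psubstM psubstX psubstC rmorphD rmorphM /= IHf mpevC.
by rewrite hornerC hornerMXaddC.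
Qed.

(* The value of u at del = d and x_i = x i. *)
Definition ev n (d : K) (x : 'I_n -> K) : {mvpoly R[n]} -> W :=
  mvext (fun m v => mmap1 x m *: E d v).

Let evD_h n d (x : 'I_n -> K) m :
  {morph (fun v => mmap1 x m *: E d v) : u v / u + v}.
Proof. by move=> u v; rewrite ED scalerDr. Qed.

Lemma evD n d (x : 'I_n -> K) : {morph ev d x : u v / u + v}.
Proof. exact: mvextD (evD_h _ _). Qed.

Lemma ev0 n d (x : 'I_n -> K) : ev d x 0 = 0.
Proof. exact: morphD0 (evD _ _). Qed.

Lemma evU n d (x : 'I_n -> K) m v : ev d x (mvpolyU m v) = mmap1 x m *: E d v.
Proof. exact: mvextU (evD_h _ _) _ _. Qed.

Lemma evC n d (x : 'I_n -> K) v : ev d x v%:V = E d v.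
Proof. by rewrite evU mmap11 scale1r. Qed.

Lemma ev_scale n d (x : 'I_n -> K) P u : ev d x (P *: u) = mpev d x P *: ev d x u.
Proof.
elim/mvpoly_ind: u => [|u v IHu IHv|k v]; first by rewrite scaler0 !ev0 scaler0.
  by rewrite scalerDr !evD IHu IHv scalerDr.
elim/mpolyind: P => [|c m P _ _ IHP]; first by rewrite scale0r ev0 rmorph0 scale0r.
rewrite scalerDl evD IHP rmorphD /= scalerDl; congr (_ + _).
rewrite mvpoly_scaleU !evU EZ /mpev mmapZ mmapX commr_mmap1_M.
  by rewrite !scalerA -!mulrA [in RHS]mulrC -!mulrA.
by move=> *; apply: mulrC.
Qed.

Lemma ev_msubst n d (x : 'I_n -> K) s p :
  ev d x (msubst s p) = ev d (fun _ => mpev d x s) p.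
Proof.
elim/mvpoly_ind: p => [|u v IHu IHv|m v]; first by rewrite msubst0 !ev0.
  by rewrite msubstD !evD IHu IHv.
by rewrite msubstU ev_scale evC evU /mmap1 big_ord1 rmorphXn.
Qed.

(** Conformal linearity turns [del] in the argument of [phi] into [d + y], which explains the point
    at which the argument is evaluated. *)
Lemma ev_cext (phi : R -> {mvpoly R[1]}) (Phi : K -> K -> W -> W)
    n d (x : 'I_n -> K) s u :
  {morph phi : a b / a + b} ->
  (forall d y, {morph Phi d y : v w / v + w}) ->
  (forall d y c w, Phi d y (c *: w) = c *: Phi d y w) ->
  (forall d y a, ev d (fun _ => y) (phi a) = Phi d y (E (d + y) a)) ->
  ev d x (cext phi s u) = Phi d (mpev d x s) (ev (d + mpev d x s) x u).
Proof.
move=> phiD PhiD PhiZ phiE.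
elim/mvpoly_ind: u => [|u v IHu IHv|m v].
- by rewrite cext0 // !ev0 (morphD0 (PhiD _ _)).
- by rewrite cextD // !evD IHu IHv PhiD.
by rewrite cextU // ev_scale ev_msubst phiE evU PhiZ /mpev mmapX.
Qed.

(** By sesquilinearity [del] acts as [- y] on the left argument and as [d + y] on the right one. *)
Lemma ev_lext (br : R -> R -> {mvpoly R[1]}) (B : K -> K -> W -> W -> W)
    n d (x : 'I_n -> K) s u v :
  (forall b, {morph br^~ b : a a' / a + a'}) ->
  (forall a, {morph br a : b b' / b + b'}) ->
  (forall d y w, {morph (B d y)^~ w : v v' / v + v'}) ->
  (forall d y v, {morph B d y v : w w' / w + w'}) ->
  (forall d y c v w, B d y (c *: v) w = c *: B d y v w) ->
  (forall d y c v w, B d y v (c *: w) = c *: B d y v w) ->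
  (forall d y a b, ev d (fun _ => y) (br a b) = B d y (E (- y) a) (E (d + y) b)) ->
  let y := mpev d x s in
  ev d x (lext br s u v) = B d y (ev (- y) x u) (ev (d + y) x v).
Proof.
move=> brDl brDr BDl BDr BZl BZr brE y.
have B0l d' y' w : B d' y' 0 w = 0 by exact: morphD0 (BDl d' y' w).
elim/mvpoly_ind: u => [|u u' IHu IHu'|m a].
- by rewrite lext0l // !ev0 B0l.
- by rewrite lextDl // !evD IHu IHu' BDl.
elim/mvpoly_ind: v => [|v v' IHv IHv'|k b].
- by rewrite lext0r // !ev0 (morphD0 (BDr _ _ _)).
- by rewrite lextDr // !evD IHv IHv' BDr.
rewrite lextUU // ev_scale ev_msubst brE !evU BZl BZr scalerA.
by rewrite /mpev mmapX commr_mmap1_M // => *; apply: mulrC.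
Qed.

End Evaluation.

(** * Elements are separated by their values *)

Section Separation.
Variables (K : numFieldType) (W : vectType K).

Lemma poly_vanish (p : {poly K}) : (forall t, p.[t] = 0) -> p = 0.
Proof.
move=> p0; apply/eqP/negP => /negP nz_p.
pose rs : seq K := [seq i%:R | i <- iota 0 (size p)].
suff : (size rs < size p)%N by rewrite size_map size_iota ltnn.
apply: max_poly_roots => //; first by apply/allP => t _; rewrite /root p0.
by rewrite map_inj_uniq ?iota_uniq // => i j /eqP; rewrite eqr_nat => /eqP.
Qed.

(** In each coordinate a polynomial vanishes on an infinite field; injectivity of [k] keeps its
    coefficients apart. *)
Lemma vpoly_vanish (I : eqType) (s : seq I) (k : I -> nat) (w : I -> W) :
  uniq s -> {in s &, injective k} ->
  (forall t, \sum_(i <- s) t ^+ k i *: w i = 0) -> {in s, forall i, w i = 0}.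
Proof.
move=> us k_inj w0 i is_; rewrite (coord_vbasis (memvf (w i))) big1 // => j _.
pose h := coord (vbasis {:W}) j; rewrite -/h.
suff : \sum_(l <- s) h (w l) *: 'X^(k l) = 0 :> {poly K}.
  move/polyP/(_ (k i)); rewrite coef_sum coef0 (bigD1_seq i) //= big_seq_cond.
  rewrite big1 => [|l /andP [ls li]].
    by rewrite coefZ coefXn eqxx mulr1 addr0 => ->; rewrite scale0r.
  rewrite coefZ coefXn; case: eqP => [/k_inj il|_]; last by rewrite mulr0.
  by rewrite il ?eqxx in li.
apply: poly_vanish => t; rewrite horner_sum -[RHS](linear0 h) -(w0 t) linear_sum.
by apply: eq_bigr => l _; rewrite hornerZ hornerXn linearZ /= mulrC.
Qed.

(** Uniqueness of base [N] digits, read off by remainder and quotient. *)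
Lemma expansion_inj N n (f g : 'I_n -> nat) :
  (forall i, f i < N)%N -> (forall i, g i < N)%N ->
  (\sum_i f i * N ^ i = \sum_i g i * N ^ i)%N -> f =1 g.
Proof.
elim: n f g => [|n IHn] f g fN gN; first by move=> _ [].
have N0 : (0 < N)%N by apply: leq_ltn_trans (fN ord0).
have split h : (\sum_(i < n.+1) h i * N ^ i =
    (\sum_(i < n) h (lift ord0 i) * N ^ i) * N + h ord0)%N.
  rewrite big_ord_recl expn0 muln1 addnC big_distrl; congr (_ + _)%N.
  by apply: eq_bigr => i _; rewrite /= /bump add1n expnSr mulnA.
rewrite !split => eqfg.
have f0 : f ord0 = g ord0.
  by have /(congr1 (modn^~ N)) := eqfg; rewrite !modnMDl !modn_small.
have fS : (f \o lift ord0) =1 (g \o lift ord0).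
  apply: IHn => [i|i|]; [exact: fN | exact: gN |].
  by have /(congr1 (divn^~ N)) := eqfg; rewrite !divnMDl // !divn_small // !addn0.
by move=> i; case: (unliftP ord0 i) => [j|] ->; [apply: fS | apply: f0].
Qed.

Variables (R : lmodType {poly K}) (E : K -> R -> W).
Hypothesis ED : forall d, {morph E d : a b / a + b}.
Hypothesis E_inj : forall a, (forall d, E d a = 0) -> a = 0.

(* Kronecker substitution: the powers t^(N^i) for the x_i separate monomials
   with exponents less than N. *)
Lemma ev_eq0 n (u : {mvpoly R[n]}) : (forall d x, ev E d x u = 0) -> u = 0.
Proof.
move=> u0; pose supp := monalg.msupp u.
pose N := (\max_(m <- supp) mdeg m).+1.
have supN m i : m \in supp -> (m i < N)%N.
  move=> ms; rewrite ltnS (leq_trans _ (leq_bigmax_seq _ ms isT)) //.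
  by rewrite mdegE (bigD1 i) //= leq_addr.
pose k (m : 'X_{1..n}) := (\sum_i m i * N ^ i)%N.
have k_inj : {in supp &, injective k}.
  move=> m m' ms ms' kmm'; apply/mnmP => i.
  exact: (expansion_inj (fun i => supN m i ms) (fun i => supN m' i ms') kmm' i).
rewrite (monalg.monalgE u) big_seq big1 // => m ms.
suff -> : monalg.mcoeff m u = 0 by rewrite monalg.monalgU0.
apply: E_inj => d.
pose w m := E d (monalg.mcoeff m u); rewrite -/(w m).
apply: (vpoly_vanish (fset_uniq _) k_inj) ms => t.
rewrite -[RHS](u0 d (fun i => t ^+ (N ^ i))) /ev /mvext mext.unlock.
apply: eq_bigr => m' _; congr (_ *: _); rewrite /mmap1 /k -prodrXr.
by apply: eq_bigr => i _; rewrite -exprM mulnC.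
Qed.

Lemma ev_inj n (u v : {mvpoly R[n]}) :
  (forall d x, ev E d x u = ev E d x v) -> u = v.
Proof.
move=> uv; apply/eqP; rewrite -subr_eq0; apply/eqP/ev_eq0 => d x.
by rewrite (evD ED) (morphDN (evD ED d x)) uv subrr.
Qed.

End Separation.

(** * The triple derivation identity in terms of values *)

Section TripleEvaluation.
Variables (K : numFieldType) (W : vectType K) (R : lieConformalType K).
Variable E : K -> R -> W.
Hypothesis ED : forall d, {morph E d : a b / a + b}.
Hypothesis EZ : forall d p a, E d (p *: a) = p.[d] *: E d a.
Hypothesis E_inj : forall a, (forall d, E d a = 0) -> a = 0.
Variable B : K -> K -> W -> W -> W.
Hypothesis BDl : forall d y w, {morph (B d y)^~ w : v v' / v + v'}.
Hypothesis BDr : forall d y v, {morph B d y v : w w' / w + w'}.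
Hypothesis BZl : forall d y c v w, B d y (c *: v) w = c *: B d y v w.
Hypothesis BZr : forall d y c v w, B d y v (c *: w) = c *: B d y v w.
Hypothesis BE : forall d y a b,
  ev E d (fun _ => y) (lbr a b) = B d y (E (- y) a) (E (d + y) b).
Variables (phi : R -> {mvpoly R[1]}) (Phi : K -> K -> W -> W).
Hypothesis gc_phi : gc R phi.
Hypothesis PhiD : forall d y, {morph Phi d y : v w / v + w}.
Hypothesis PhiZ : forall d y c w, Phi d y (c *: w) = c *: Phi d y w.
Hypothesis PhiE : forall d y a, ev E d (fun _ => y) (phi a) = Phi d y (E (d + y) a).

(** One direction evaluates the identity at [l], [m], [x]; the other holds because values separate
    elements. *)
Lemma CTDer_ev : CTDer R phi <-> forall d l m x a b c,
  Phi d x (B (d + x) (l + m) (B (- (l + m)) l (E (- l) a) (E (- m) b))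
                             (E (d + l + m + x) c)) =
  B d (l + m + x)
    (B (- (l + m + x)) (l + x) (Phi (- (l + x)) x (E (- l) a)) (E (- m) b))
    (E (d + l + m + x) c) +
  B d (l + m + x)
    (B (- (l + m + x)) l (E (- l) a) (Phi (- (m + x)) x (E (- m) b)))
    (E (d + l + m + x) c) +
  B d (l + m) (B (- (l + m)) l (E (- l) a) (E (- m) b))
              (Phi (d + l + m) x (E (d + l + m + x) c)).
Proof.
have [phiD _ _] := gc_phi.
have evc n d (x : 'I_n -> K) s u :
    ev E d x (cext phi s u) = Phi d (mpev d x s) (ev E (d + mpev d x s) x u).
  exact: ev_cext.
have evl n d (x : 'I_n -> K) s u v : ev E d x (lext lbr s u v) =
    B d (mpev d x s) (ev E (- mpev d x s) x u) (ev E (d + mpev d x s) x v).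
  by apply: ev_lext => //; [apply: lbrDl | apply: lbrDr].
have mpevD n d (x : 'I_n -> K) s t : mpev d x (s + t) = mpev d x s + mpev d x t.
  exact: rmorphD.
pose ev_simp := (evc, evl, evC ED, mpevD, mpevX).
(* These equations simplify the values of [del] that the nested brackets produce. *)
have a1 d l m x : d + x + (l + m) = d + l + m + x :> K by ring.
have a2 l m : - (l + m) + l = - m :> K by ring.
have a3 l m x : - (l + m + x) + (l + x) = - m :> K by ring.
have a4 l x : - (l + x) + x = - l :> K by ring.
have a5 l m x : - (l + m + x) + l = - (m + x) :> K by ring.
have a6 d l m x : d + (l + m + x) = d + l + m + x :> K by ring.
have a7 d l m : d + (l + m) = d + l + m :> K by ring.
split=> [[_ trphi] d l m x a b c|trphi].
  pose X (i : 'I_3) := nth 0 [:: l; m; x] i.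
  have := congr1 (ev E d X) (trphi a b c).
  rewrite /= !(evD ED) !ev_simp /X /=.
  by rewrite !(a1, a2, a3, a4, a5, a6, a7).
split=> // a b c; apply: (ev_inj ED E_inj) => d X /=.
rewrite !(evD ED) !ev_simp.
by rewrite !(a1, a2, a3, a4, a5, a6, a7) trphi.
Qed.

End TripleEvaluation.

(** * The Virasoro conformal algebra *)

Lemma CInn_gc (K : fieldType) (R : lieConformalType K) (a : R) : gc R (ad a).
Proof. by split=> *; [apply: lbrDr | apply: lbrZr | apply: lbrXr]. Qed.

(* Comparing leading coefficients, 2^n = 2. *)
Lemma size_affine_doubling (K : numFieldType) (p : {poly K}) e c :
  (forall t, p.[t * 2 + e] = p.[t] * 2 + c) -> (size p <= 2)%N.
Proof.
move=> pE; rewrite leqNgt; apply/negP => sp.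
pose q : {poly K} := 2 *: 'X + e%:P.
have q1 : size q = 2%N.
  rewrite size_polyDl ?size_scale ?size_polyX ?pnatr_eq0 // size_polyC.
  by case: (e == 0).
have pq : p \Po q = 2 *: p + c%:P.
  apply/eqP; rewrite -subr_eq0; apply/eqP/poly_vanish => t.
  by rewrite hornerD hornerN horner_comp /q !hornerE mulrC pE mulrC subrr.
have s2 : size (2 *: p) = size p by rewrite size_scale ?pnatr_eq0.
have q2 : lead_coef q = 2.
  rewrite /q lead_coefDl ?lead_coefZ ?lead_coefX ?mulr1 //.
  by rewrite size_scale ?size_polyX ?pnatr_eq0 // size_polyC; case: (e == 0).
have := congr1 lead_coef pq.
rewrite lead_coef_comp ?q1 // q2 lead_coefDl; last first.
  by rewrite s2 size_polyC; apply: leq_trans sp; case: (c == 0).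
rewrite lead_coefZ mulrC => /(mulIf _) /eqP; rewrite lead_coef_eq0.
rewrite -size_poly_eq0 -[_ == 0%N]negbK -lt0n (ltnW (ltnW sp)) => /(_ isT).
rewrite -natrX eqr_nat -[X in _ == X]expn1 eqn_exp2l //.
by case: (size p) sp => [|[|[|n]]].
Qed.

Section VirTriple.
Variable K : numFieldType.

Let E (d : K) (p : Vir K) : K^o := (p : {poly K}).[d].

Let ED d : {morph E d : a b / a + b}.
Proof. by move=> a b; rewrite /E hornerD. Qed.

Let EZ d p a : E d (p *: a) = p.[d] *: E d a.
Proof. exact: hornerM. Qed.

Let E_inj a : (forall d, E d a = 0) -> a = 0.
Proof. exact: poly_vanish. Qed.

Let B (d y : K) (v w : K^o) : K^o := (v : K) * w * (d + y * 2).

Let BDl d y w : {morph (B d y)^~ w : v v' / v + v'}.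
Proof. by move=> v v'; rewrite /B -[v + v']/((v : K) + v'); ring. Qed.

Let BDr d y v : {morph B d y v : w w' / w + w'}.
Proof. by move=> w w'; rewrite /B -[w + w']/((w : K) + w'); ring. Qed.

Let BZl d y c v w : B d y (c *: v) w = c *: B d y v w.
Proof. by rewrite /B -[c *: v]/(c * v) -!mulrA. Qed.

Let BZr d y c v w : B d y v (c *: w) = c *: B d y v w.
Proof. by rewrite /B -[c *: w]/(c * w) mulrCA -!mulrA. Qed.

Let BE d y a b : ev E d (fun _ => y) (lbr a b) = B d y (E (- y) a) (E (d + y) b).
Proof.
rewrite -[lbr a b]/(vir_br a b) /vir_br (ev_scale ED EZ) (evC ED) /E /vir_L hornerC.
rewrite !(rmorphD, rmorphM, rmorphN, rmorphMn) /= !mpev_psubst.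
rewrite !(rmorphD, rmorphN) /= !mpevX mpev_del /B [LHS]mulr1.
by congr (_ * _); ring.
Qed.

(** The outer variable of [P] stands for [del], so that its coefficients are polynomials in [x]. *)
Lemma vir_coef (u : {mvpoly (Vir K)[1]}) :
  exists P : {poly {poly K}}, forall d x, ev E d (fun _ => x) u = P.[d%:P].[x].
Proof.
elim/mvpoly_ind: u => [|u v [P uP] [Q vQ]|m v].
- by exists 0 => d x; rewrite (ev0 ED) !horner0.
- by exists (P + Q) => d x; rewrite (evD ED) uP vQ !hornerD.
exists (map_poly polyC (v : {poly K}) * ('X^(m ord0))%:P) => d x.
rewrite (evU ED) hornerM hornerC horner_map hornerM hornerC hornerXn.
by rewrite /mmap1 big_ord1 mulrC.
Qed.

Lemma CTDer_Vir : CTDer (Vir K) = CInn (Vir K).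
Proof.
apply/seteqP; split=> [phi phiT|_ [a _ <-]]; last first.
  apply/(CTDer_ev ED EZ E_inj BDl BDr BZl BZr BE (CInn_gc a)
           (Phi := fun d y w => B d y (E (- y) a) w)) => // d l m x u v w.
  by rewrite /B /=; ring.
have [[phiD phiZ phiX] _] := phiT; have [P PE] := vir_coef (phi (vir_L K)).
pose F d x : K := P.[d%:P].[x].
have phiE d y a : ev E d (fun _ => y) (phi a) = (E (d + y) a : K) * F d y.
  move: a; apply: vir_gen => [a b IHa IHb|c a IHa|a IHa|_ ->].
  - by rewrite phiD (evD ED) IHa IHb ED mulrDl.
  - by rewrite phiZ (ev_scale ED EZ) mpevC hornerC IHa EZ hornerC -mulrA.
  - rewrite phiX (ev_scale ED EZ) rmorphD /= mpev_del mpevX IHa EZ hornerX.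
    by rewrite -mulrA.
  by rewrite PE /E /vir_L hornerC mul1r.
pose Phi (d y : K) (w : K^o) : K^o := (w : K) * F d y.
have PhiD d y : {morph Phi d y : v w / v + w} by move=> v w; apply: mulrDl.
have PhiZ d y c w : Phi d y (c *: w) = c *: Phi d y w.
  by rewrite /Phi -[c *: w]/(c * w) -mulrA.
have [trphi _] := CTDer_ev ED EZ E_inj BDl BDr BZl BZr BE phiT.1 PhiD PhiZ phiE.
(* At [d = 2t + 2x], [l - m = 1] and [l + m = - t - 2x], the factor [d + 2(l + m + x)] is 0 and
   kills the first two terms on the right, while [d + l + m = t]. *)
have FE t x : x * F (t * 2 + x * 2) x = x * (F t x * 2).
  have := trphi phiT (t * 2 + x * 2) ((1 - t - x * 2) / 2) ((- 1 - t - x * 2) / 2) x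
    (vir_L K) (vir_L K) (vir_L K).
  rewrite /B /Phi /E /vir_L !hornerC.
  have -> : t * 2 + x * 2 + (1 - t - x * 2) / 2 + (- 1 - t - x * 2) / 2 = t by field.
  set G1 := F (- _) x; set G2 := F (- _) x; set G := F _ x; set H := F t x.
  move: G1 G2 G H => G1 G2 G H /eqP; rewrite -subr_eq0 => /eqP e.
  apply/eqP; rewrite -subr_eq0 -oppr_eq0; apply/eqP; rewrite -[RHS]e.
  by field.
have FpX x : F^~ x =1 horner (map_poly (horner_eval x) P).
  by move=> d; rewrite -[d in RHS](hornerC d x) horner_map.
(* For [x != 0] the relation bounds the degree in [d] by 1, and [t = 0] ties the constant term to
   the slope. *)
have FpE d x : x != 0 -> F d x = (P`_1).[x] * (d + x * 2).
  move=> x0; set p := map_poly (horner_eval x) P.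
  have pE t : p.[t * 2 + x * 2] = p.[t] * 2 + 0.
    by rewrite -!FpX addr0; apply: (mulfI x0).
  have p01 t : p.[t] = p`_0 + p`_1 * t.
    rewrite (horner_coef_wide _ (size_affine_doubling pE)) !big_ord_recr big_ord0 /=.
    by rewrite expr0 expr1 mulr1 add0r.
  have p0 : p`_0 = p`_1 * (x * 2).
    have := pE 0; rewrite !p01 => /eqP; rewrite -subr_eq0 => /eqP e.
    by apply/eqP; rewrite -subr_eq0 -oppr_eq0; apply/eqP; rewrite -[RHS]e; ring.
  by rewrite (FpX x d) p01 p0 /p !coef_map /= /horner_eval; ring.
(* Both sides are polynomials in [x] that agree off 0; multiplying their difference by ['X] also
   covers [x = 0]. *)
have {}FpE d x : F d x = (P`_1).[x] * (d + x * 2).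
  pose Q : {poly K} := P.[d%:P] - P`_1 * (d%:P + 'X * 2%:P).
  suff Q0 : 'X * Q = 0.
    have /eqP := Q0; rewrite mulf_eq0 polyX_eq0 /= subr_eq0 => /eqP PQ.
    by rewrite /F PQ !hornerE.
  apply: poly_vanish => y; rewrite hornerM hornerX.
  have [->|y0] := eqVneq y 0; first by rewrite mul0r.
  by rewrite /Q hornerD hornerN -/(F d y) FpE // !hornerE subrr mulr0.
(* The sign compensates for [ad a] evaluating [a] at [- x]. *)
exists (P`_1 \Po - 'X) => //; apply/funext => b.
apply: (ev_inj ED E_inj) => d x; rewrite (_ : x = fun _ => x ord0); last first.
  by apply/funext => i; rewrite ord1.
rewrite phiE -[ad _ b]/(lbr _ b) BE /B /E horner_comp !hornerE opprK FpE.
by ring.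
Qed.

End VirTriple.

(** * Current conformal algebras *)

Lemma linfun_linear (K : fieldType) (V W : vectType K) (f : V -> W) :
  linear f -> linfun f =1 f.
Proof.
move=> f_lin; pose L := GRing.isLinear.Build K V W _ f f_lin.
by pose fL : {linear V -> W} := HB.pack f L; apply: (lfunE fL).
Qed.

Section CurTriple.
Variables (K : numClosedFieldType) (G : vectLieAlgType K).
Hypothesis simpleG : lie_simple G.

Lemma cur_ind (Q : Cur G -> Prop) : (forall u v, Q u -> Q v -> Q (u + v)) ->
  (forall u, Q u -> Q ('X *: u)) -> (forall a, Q (cur_in a)) -> forall u, Q u.
Proof.
move=> QD QX Qin; elim/upoly_ind => [|//|i a].
  by rewrite -(morphD0 (@cur_inD _ G)); apply: Qin.
elim: i => [|i IHi]; first exact: Qin.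
by rewrite -upoly_scaleX; apply: QX.
Qed.

Lemma cur_inZ c (a : G) : cur_in (c *: a) = c%:P *: cur_in a.
Proof. by rewrite /cur_in upoly_scaleC. Qed.

Definition cur_ev (d : K) : Cur G -> G := uext (fun i a => d ^+ i *: a).

Let E := cur_ev.

Let ED d : {morph E d : a b / a + b}.
Proof. by apply: uextD => i a b; rewrite scalerDr. Qed.

Let EU d i a : E d (upolyU i a) = d ^+ i *: a.
Proof. by apply: uextU => j b c; rewrite scalerDr. Qed.

Let E_in d a : E d (cur_in a) = a.
Proof. by rewrite EU expr0 scale1r. Qed.

Let EX d u : E d ('X *: u) = d *: E d u.
Proof.
elim/upoly_ind: u => [|u v IHu IHv|i a].
- by rewrite scaler0 (morphD0 (ED d)) scaler0.
- by rewrite scalerDr !ED IHu IHv scalerDr.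
by rewrite upoly_scaleX !EU scalerA exprS.
Qed.

Let EZ d p u : E d (p *: u) = p.[d] *: E d u.
Proof.
elim/poly_ind: p u => [|p c IHp] u.
  by rewrite horner0 !scale0r (morphD0 (ED d)).
rewrite scalerDl -scalerA ED IHp EX hornerMXaddC scalerDl scalerA; congr (_ + _).
elim/upoly_ind: u => [|u v IHu IHv|i a].
- by rewrite scaler0 (morphD0 (ED d)) scaler0.
- by rewrite scalerDr !ED IHu IHv scalerDr.
by rewrite upoly_scaleC !EU !scalerA mulrC.
Qed.

Let E_inj u : (forall d, E d u = 0) -> u = 0.
Proof.
move=> u0; rewrite [u](monalg.monalgE u) big_seq big1 // => i iu.
suff -> : monalg.mcoeff i u = 0 by rewrite monalg.monalgU0.
pose w j := monalg.mcoeff j u; rewrite -/(w i).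
apply: (vpoly_vanish (k := id) (fset_uniq _)) iu => // t.
by rewrite -[RHS](u0 t) /E /cur_ev /uext mext.unlock.
Qed.

Let B (d y : K) (v w : G) : G := lie v w.

Let BDl d y w : {morph (B d y)^~ w : v v' / v + v'}.
Proof. by move=> v v'; apply: lieDl. Qed.

Let BDr d y v : {morph B d y v : w w' / w + w'}.
Proof. by move=> w w'; apply: lieDr. Qed.

Let BZl d y c v w : B d y (c *: v) w = c *: B d y v w.
Proof. exact: lieZl. Qed.

Let BZr d y c v w : B d y v (c *: w) = c *: B d y v w.
Proof. exact: lieZr. Qed.

Let BE d y (u v : Cur G) :
  ev E d (fun _ => y) (lbr u v) = B d y (E (- y) u) (E (d + y) v).
Proof.
move: u; apply: cur_ind => [u u' IHu IHu'|u IHu|a].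
- by rewrite (lbrDl v u u') (evD ED) IHu IHu' ED BDl.
- by rewrite lbrXl (ev_scale ED EZ) rmorphN /= mpevX IHu EX BZl.
move: v; apply: cur_ind => [v v' IHv IHv'|v IHv|b].
- by rewrite (lbrDr _ v v') (evD ED) IHv IHv' ED BDr.
- by rewrite lbrXr (ev_scale ED EZ) rmorphD /= mpevX mpev_del IHv EX BZr.
by rewrite -[lbr _ _]/(cur_br _ _) cur_brE (evC ED) !E_in.
Qed.

Section Phi.
Variable phi : Cur G -> {mvpoly (Cur G)[1]}.
Hypothesis gc_phi : gc (Cur G) phi.

(** The linear maps [Phi_y(d)] on [G]. They determine [phi], since a conformal map is determined by
    its values on [G]. *)
Definition cur_symbol d y (w : G) : G := ev E d (fun _ : 'I_1 => y) (phi (cur_in w)).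

Let Phi := cur_symbol.

Let PhiD d y : {morph Phi d y : v w / v + w}.
Proof.
have [phiD _ _] := gc_phi.
by move=> v w; rewrite /Phi /cur_symbol cur_inD phiD (evD ED).
Qed.

Let PhiZ d y c w : Phi d y (c *: w) = c *: Phi d y w.
Proof.
have [_ phiZ _] := gc_phi.
by rewrite /Phi /cur_symbol cur_inZ phiZ (ev_scale ED EZ) mpevC hornerC.
Qed.

Let PhiE d y u : ev E d (fun _ => y) (phi u) = Phi d y (E (d + y) u).
Proof.
have [phiD _ phiX] := gc_phi.
move: u; apply: cur_ind => [u v IHu IHv|u IHu|a]; last by rewrite E_in.
  by rewrite phiD (evD ED) IHu IHv ED PhiD.
by rewrite phiX (ev_scale ED EZ) rmorphD /= mpev_del mpevX IHu EX PhiZ.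
Qed.

(** For fixed [x], [y1 = - (l + x)], [y2 = - (m + x)], [y3 = d + l + m] is an invertible change of
    variables, with [d = y1 + y2 + y3 + 2x]. *)
Lemma CTDer_Cur_symbol : CTDer (Cur G) phi <-> forall y1 y2 y3 x a b c,
  Phi (y1 + y2 + y3 + x * 2) x (lie (lie a b) c) =
    lie (lie (Phi y1 x a) b) c + lie (lie a (Phi y2 x b)) c +
    lie (lie a b) (Phi y3 x c).
Proof.
rewrite (CTDer_ev ED EZ E_inj BDl BDr BZl BZr BE gc_phi PhiD PhiZ PhiE).
split=> [tri y1 y2 y3 x a b c|tri d l m x u v w].
  have := tri (y1 + y2 + y3 + x * 2) (- y1 - x) (- y2 - x) x
    (cur_in a) (cur_in b) (cur_in c).
  rewrite !E_in /B.
  have -> : - (- y1 - x + x) = y1 by ring.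
  have -> : - (- y2 - x + x) = y2 by ring.
  by have -> : y1 + y2 + y3 + x * 2 + (- y1 - x) + (- y2 - x) = y3 by ring.
by rewrite /B -tri; congr (Phi _ _ _); ring.
Qed.

Lemma cur_symbol_polynomial (u : {mvpoly (Cur G)[1]}) :
  exists P : 'I_(\dim {:G}) -> {poly {poly K}}, forall d y,
    ev E d (fun _ => y) u = \sum_k (P k).[d%:P].[y] *: (vbasis {:G})`_k.
Proof.
elim/mvpoly_ind: u => [|u v [P uP] [Q vQ]|m v].
- exists (fun _ => 0) => d y; rewrite (ev0 ED) big1 // => k _.
  by rewrite !horner0 scale0r.
- exists (fun k => P k + Q k) => d y; rewrite (evD ED) uP vQ -big_split.
  by apply: eq_bigr => k _; rewrite !hornerD scalerDl.
have [P vP] : exists P : 'I_(\dim {:G}) -> {poly K}, forall d,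
    E d v = \sum_k (P k).[d] *: (vbasis {:G})`_k.
  move: v; apply: cur_ind => [u v [P uP] [Q vQ]|v [P vP]|a].
  - exists (fun k => P k + Q k) => d; rewrite ED uP vQ -big_split.
    by apply: eq_bigr => k _; rewrite !hornerD scalerDl.
  - exists (fun k => 'X * P k) => d; rewrite EX vP scaler_sumr.
    by apply: eq_bigr => k _; rewrite hornerM hornerX scalerA.
  exists (fun k => (coord (vbasis {:G}) k a)%:P) => d.
  rewrite E_in [LHS](coord_vbasis (memvf a)).
  by apply: eq_bigr => k _; rewrite hornerC.
exists (fun k => map_poly polyC (P k) * ('X^(m ord0))%:P) => d y.
rewrite (evU ED) vP scaler_sumr; apply: eq_bigr => k _.
rewrite hornerM hornerC horner_map hornerM hornerC hornerXn.
by rewrite /mmap1 big_ord1 scalerA mulrC.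
Qed.

Lemma CTDer_Cur_inner : CTDer (Cur G) phi -> exists (f : {poly K}) (U : Cur G),
  forall a, phi (cur_in a) =
    (psubst 'X_0 f * (del + 'X_0)) *: (cur_in a)%:V + ad U (cur_in a).
Proof.
move/CTDer_Cur_symbol => tri.
pose n := \dim {:G}; pose b := vbasis {:G}.
have [P PE] :=
  fin_all_exists (fun l : 'I_n => cur_symbol_polynomial (phi (cur_in b`_l))).
have Phi_sum d x w : Phi d x w = \sum_l coord b l w *: Phi d x b`_l.
  rewrite [w in LHS](coord_vbasis (memvf w)).
  rewrite (big_morph _ (PhiD d x) (morphD0 (PhiD d x))).
  by apply: eq_bigr => l _; rewrite PhiZ.
(* For [t = s + 2x] and [w] a triple bracket, the identities at [(s,s,0)] and [(0,0,0)] have the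
   same sum as those at [(s,0,0)] and [(0,s,0)]. Perfectness, used twice, reaches every [w]. *)
have doubling x w t :
    Phi (t * 2 - x * 2) x w + Phi (x * 2) x w = Phi t x w + Phi t x w.
  move: w; apply: (simple_perfect simpleG) => [v w IHv IHw|u c].
    by rewrite !PhiD addrACA IHv IHw addrACA.
  move: u; apply: (simple_perfect simpleG) => [u v IHu IHv|a a'].
    by rewrite !lieDl !PhiD addrACA IHu IHv addrACA.
  have [s ->] : exists s, t = s + x * 2 by exists (t - x * 2); ring.
  have -> : (s + x * 2) * 2 - x * 2 = s + s + x * 2 by ring.
  have := tri s s 0 x a a' c; rewrite addr0 => h0.
  have := tri s 0 0 x a a' c; rewrite !addr0 => h1.
  have := tri 0 s 0 x a a' c; rewrite add0r addr0 => h2.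
  have := tri 0 0 0 x a a' c; rewrite !add0r => h3.
  rewrite h0 h3 {1}h1 h2 addrACA [RHS]addrACA; congr (_ + _).
  by rewrite [LHS]addrACA [RHS]addrACA [X in _ + X]addrC.
(* [ce l k] is the elementary map from the [l]-th to the [k]-th basis vector; [T i x] below collects
   the coefficient of [d ^ i] in [Phi d x]. *)
pose ce l k : 'End(G) := linfun (fun w => coord b l w *: b`_k).
have ceE l k w : ce l k w = coord b l w *: b`_k.
  rewrite linfun_linear // => c u v.
  by rewrite linearP scalerDl scalerA.
pose T i x : 'End(G) := \sum_l \sum_k ((P l k)`_i).[x] *: ce l k.
have TE i x w : T i x w = \sum_l coord b l w *: \sum_k ((P l k)`_i).[x] *: b`_k.
  rewrite /T sum_lfunE; apply: eq_bigr => l _.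
  rewrite sum_lfunE scaler_sumr; apply: eq_bigr => k _.
  by rewrite scale_lfunE ceE !scalerA mulrC.
(* By [doubling], each coordinate satisfies [p(2t - 2x) = 2 p(t) - p(2x)], so it is affine in
   [d]. *)
have sP l k : (size (P l k) <= 2)%N.
  apply/leq_sizeP => j j2; apply: poly_vanish => x.
  pose p := map_poly (horner_eval x) (P l k).
  have pE d : p.[d] = coord b k (Phi d x b`_l).
    rewrite /Phi /cur_symbol PE coord_sum_free ?(basis_free (vbasisP _)) //.
    by rewrite -[d in LHS](hornerC d x) horner_map.
  have /size_affine_doubling :
      forall t, p.[t * 2 + - (x * 2)] = p.[t] * 2 + - p.[x * 2].
    move=> t; rewrite !pE; apply/eqP; rewrite eq_sym subr_eq; apply/eqP.
    by rewrite -linearD doubling linearD -mulr2n mulr_natr.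
  by move/leq_sizeP/(_ j j2); rewrite coef_map.
have PhiT d x w : Phi d x w = T 0 x w + d *: T 1 x w.
  rewrite Phi_sum !TE scaler_sumr -big_split; apply: eq_bigr => l _ /=.
  rewrite scalerA mulrC -scalerA -scalerDr; congr (_ *: _).
  rewrite /Phi /cur_symbol PE scaler_sumr -big_split; apply: eq_bigr => k _ /=.
  rewrite scalerA -scalerDl; congr (_ *: _).
  rewrite (horner_coef_wide _ (sP l k)) !big_ord_recr big_ord0 /= add0r expr0 mulr1.
  by rewrite expr1 hornerD hornerM hornerC mulrC.
(* The difference of the identities at [(0,0,1)] and [(0,0,0)] isolates the slope. *)
have T1_centroid x : exists c, forall w, T 1 x w = c *: w.
  apply: (centroid_scalar simpleG) => u w.
  move: u; apply: (simple_perfect simpleG) => [u v IHu IHv|a a'].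
    by rewrite !lieDl linearD /= IHu IHv.
  have := tri 0 0 1 x a a' w; have := tri 0 0 0 x a a' w.
  rewrite !PhiT !scale0r !addr0 !add0r scale1r lieDr => h0.
  by rewrite addrA -h0 scalerDl scale1r addrCA [RHS]addrC => /addIr.
have n_gt0 : (0 < n)%N.
  rewrite lt0n dimv_eq0; have [u [v uv0]] := simpleG.1; apply/negP => /eqP G0.
  by have := memvf (lie u v); rewrite G0 memv0 (negbTE uv0).
have [l0 _] : exists l0 : 'I_n, true by exists (Ordinal n_gt0).
(* A diagonal entry of [T 1 x] equals its scalar, which is therefore polynomial in [x]. *)
pose f := (P l0 l0)`_1.
have free_b : free b by apply: basis_free (vbasisP _).
have T1E x w : T 1 x w = f.[x] *: w.
  have [c cE] := T1_centroid x; rewrite cE; congr (_ *: _).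
  have := congr1 (coord b l0) (cE b`_l0).
  rewrite linearZ /= coord_free // eqxx mulr1 => <-.
  rewrite TE (bigD1 l0) //= [X in _ + X]big1 => [|l ll0]; last first.
    by rewrite coord_free // eq_sym (negbTE ll0) scale0r.
  by rewrite coord_free // eqxx scale1r addr0 coord_sum_free.
(* At [(0,0,0)] the left side has an extra [2x f(x)]; subtracting [x f(x)] once on the left and
   three times on the right absorbs it. *)
pose D x : 'End(G) := T 0 x - (x * f.[x]) *: \1%VF.
have DE x w : D x w = T 0 x w - (x * f.[x]) *: w.
  by rewrite add_lfunE opp_lfunE scale_lfunE id_lfunE.
have D_inner x : exists z, forall w, D x w = lie z w.
  apply: (triple_derivation_inner simpleG) => a a' c.
  have := tri 0 0 0 x a a' c; rewrite !PhiT !T1E !scale0r !addr0 !add0r.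
  rewrite !DE !(lieDl, lieDr, lieNl, lieNr, lieZl, lieZr) => /eqP.
  set g := lie (lie a a') c; rewrite eq_sym -subr_eq => /eqP <-.
  set h := (x * f.[x]) *: g.
  have -> : (x * 2) *: (f.[x] *: g) = h + h.
    by rewrite scalerA -scalerDl; congr (_ *: _); ring.
  by rewrite opprD [X in _ = X + _]addrACA [RHS]addrACA !addrA.
have ad_inj : lker (linfun (@lfun_ad K G)) == 0%VS.
  rewrite -subv0; apply/subvP => z; rewrite memv_ker lfunE /= memv0 => /eqP z0.
  apply/eqP/(simple_center simpleG) => w.
  by rewrite lieC -lfun_adE z0 zero_lfunE oppr0.
(* A linear left inverse of [ad] makes [z x] depend polynomially on [x]. *)
pose adinv := (linfun (@lfun_ad K G))^-1%VF.
pose z x := adinv (D x).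
have DzE x w : D x w = lie (z x) w.
  have [y Dy] := D_inner x; suff -> : z x = y by [].
  suff Dad : D x = linfun (@lfun_ad K G) y by rewrite /z Dad lker0_lfunK.
  by apply/lfunP => v; rewrite Dy lfunE /= lfun_adE.
(* This is [z x] expanded in the elementary maps, with [- 'X] for [x] because [ad U] evaluates [U]
   at [- x]. *)
pose U : Cur G := \sum_l \sum_k ((P l k)`_0 \Po - 'X) *: cur_in (adinv (ce l k)) -
  (('X * f) \Po - 'X) *: cur_in (adinv \1%VF).
have E_sum d I (r : seq I) (F : I -> Cur G) :
    E d (\sum_(i <- r) F i) = \sum_(i <- r) E d (F i).
  exact: (big_morph _ (ED d) (morphD0 (ED d))).
have UE x : E (- x) U = z x.
  rewrite /U ED (morphDN (ED _)) E_sum /z /D linearB linearZ /= linear_sum.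
  congr (_ - _); last by rewrite EZ E_in horner_comp !hornerE opprK.
  apply: eq_bigr => l _; rewrite E_sum linear_sum; apply: eq_bigr => k _.
  by rewrite EZ E_in horner_comp hornerN hornerX opprK linearZ.
exists f, U => a; apply: (ev_inj ED E_inj) => d x.
rewrite (_ : x = fun _ => x ord0); last by apply/funext => i; rewrite ord1.
move: (x ord0) => {}x; rewrite -[LHS]/(Phi d x a) PhiT T1E (evD ED) (ev_scale ED EZ).
rewrite rmorphM rmorphD /= mpev_psubst mpevX mpev_del (evC ED) -[ad _ _]/(lbr _ _) BE.
rewrite UE !E_in /B -DzE DE scalerA [RHS]addrC -[RHS]addrA; congr (_ + _).
by rewrite [RHS]addrC -scalerBl; congr (_ *: _); ring.
Qed.

(** The scalar parts agree since [(y1 + x) + (y2 + x) + (y3 + x) = (y1 + y2 + y3 + 2x) + x]; the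
    inner part obeys the Leibniz rule. *)
Lemma CTDer_Cur_scalar (f : {poly K}) (U : Cur G) :
  (forall a, phi (cur_in a) =
    (psubst 'X_0 f * (del + 'X_0)) *: (cur_in a)%:V + ad U (cur_in a)) ->
  CTDer (Cur G) phi.
Proof.
move=> phi_in; apply/CTDer_Cur_symbol => y1 y2 y3 x a b c.
have PhiF d w : Phi d x w = (f.[x] * (d + x)) *: w + lie (E (- x) U) w.
  rewrite /Phi /cur_symbol phi_in (evD ED) (ev_scale ED EZ) rmorphM rmorphD /=.
  by rewrite mpev_psubst mpevX mpev_del (evC ED) -[ad _ _]/(lbr _ _) BE /B !E_in.
rewrite !PhiF; move: (E (- x) U) => u.
rewrite !(lie_leibniz u) !(lieDl, lieDr, lieZl, lieZr).
rewrite [X in _ = X + _]addrACA [RHS]addrACA -!scalerDl; congr (_ *: _ + _).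
by ring.
Qed.

End Phi.

Lemma CTDer_Cur : CTDer (Cur G) =
  [set phi | gc (Cur G) phi /\
     exists (f : {poly K}) (d : Cur G -> {mvpoly (Cur G)[1]}),
       CInn (Cur G) d /\
       forall a : G, phi (cur_in a) =
         (psubst 'X_0 f * (del + 'X_0)) *: (cur_in a)%:V + d (cur_in a)]%classic.
Proof.
apply/seteqP; split=> [phi phiT|phi [gc_phi [f [_ [[U _ <-] phiE]]]]].
  split; first by case: phiT.
  have [f [U phiE]] := CTDer_Cur_inner phiT.1 phiT.
  by exists f, (ad U); split=> //; exists U.
exact: (CTDer_Cur_scalar gc_phi phiE).
Qed.

End CurTriple.

Local Open Scope classical_set_scope.

Theorem corollary4p7 (R : realType) :
  CTDer (Vir R[i]) = CInn (Vir R[i]) /\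
  (forall G : vectLieAlgType R[i], lie_simple G ->
    CTDer (Cur G) =
    [set phi | gc (Cur G) phi /\
       exists (f : {poly R[i]}) (d : Cur G -> {mvpoly (Cur G)[1]}),
         CInn (Cur G) d /\
         forall a : G, phi (cur_in a) =
           (psubst 'X_0 f * (del + 'X_0)) *: (cur_in a)%:V + d (cur_in a)]).
Proof.
split; first exact: CTDer_Vir.
by move=> G simpleG; apply: CTDer_Cur.
Qed.
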